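(* Let $\vec w = (w_0, w_1, w_2, \ldots)$ be a sequence of non-negative weights with $w_0 > 0$. Let $M_n$ be a symmetric simply generated meander system on $2n$ points with weight sequence $\vec w$ (for both the upper and the lower pairing), and let $c(M_n)$ denote the number of connected components (cycles) of $M_n$. Then $$\mathbb{E}\, c(M_n) \gtrsim \frac{1}{2}\Big(\frac{w_0}{\theta(\tau)}\Big)^2 n,$$ that is, there is a sequence $\varepsilon_n \to 0$ such that $\mathbb{E}\, c(M_n) \ge \frac{1}{2}\big(\frac{w_0}{\theta(\tau)}\big)^2 n\,(1+\varepsilon_n)$ for all $n$ (for which the model is defined), where $\theta$ and $\tau$ are the generating function and parameter associated with $\vec w$.
   Context: A pairing of $[2n]=\{1,\ldots,2n\}$ (a partition into $n$ pairs) is non-crossing if there are no $\alpha<\beta<\gamma<\delta$ such that $\alpha$ is paired with $\gamma$ and $\beta$ with $\delta$. A meander system on $2n$ points is a pair $M=(P_1,P_2)$ of non-crossing pairings of $[2n]$; $P_1$ (upper) is drawn by non-intersecting arcs in the upper half-plane and $P_2$ (lower) in the lower half-plane, connecting the points $(1,0),\ldots,(2n,0)$. Its cycles are the connected components of the resulting union of curves; equivalently, the connected components of the multigraph on vertex set $[2n]$ with edge set $P_1\sqcup P_2$. Let $\mathcal T_{m}$ be the set of rooted planar (ordered) trees on $m$ vertices. There is a standard bijection $\beta$ from $\mathcal T_{n+1}$ to non-crossing pairings of $[2n]$: traverse the tree in depth-first (contour) order, which gives $2n$ steps (a Dyck path), each edge being traversed once away from the root, at some step $a$, and once towards the root, at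 some step $b>a$; the pairing consists of all such pairs $(a,b)$. For a weight sequence $\vec w=(w_0,w_1,\ldots)$ with $w_0>0$, $w_i\ge 0$, the weight of a tree $T$ is $w(T)=\prod_{d\ge 0} w_d^{N_d(T)}$, where $N_d(T)$ is the number of vertices of out-degree $d$ in $T$. A simply generated random tree on $m$ vertices with weight sequence $\vec w$ is an element $T$ of $\mathcal T_m$ chosen with probability $w(T)/Z_m$, where $Z_m=\sum_{T\in\mathcal T_m} w(T)$ (defined when $Z_m>0$). A symmetric simply generated meander system on $2n$ points with weights $\vec w$ is the pair $(\beta(T_n),\beta(T_n'))$, where $T_n,T_n'$ are two independent simply generated random trees on $n+1$ vertices, both with weight sequence $\vec w$; it is considered for those $n$ for which $Z_{n+1}>0$. Let $\theta(t)=\sum_{k\ge 0} w_k t^k$, let $\rho\in[0,\infty]$ be the radius of convergence of this series, and let $\psi(t)=t\theta'(t)/\theta(t)$, which is non-decreasing on $[0,\rho)$. Define $\tau=\inf\{t:\psi(t)=1\}$ if $\sup_{t\uparrow\rho}\psi(t)\ge 1$, and $\tau=\rho$ otherwise. Values of $\theta$ and $\psi$ at $\rho$ are understood as limits as $t\uparrow\rho$, with $w_0/\infty=0$. *)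

(* Defs.v *)
From HB Require Import structures.
From mathcomp Require Import all_boot all_order all_algebra zify.

Set Implicit Arguments.
Unset Strict Implicit.
Unset Printing Implicit Defensive.

Unset Elimination Schemes.
Inductive tree := Node of seq tree.
Set Elimination Schemes.

Definition tree_ind (K : tree -> Prop)
    (IH : forall ts, foldr (fun t => and (K t)) True ts -> K (Node ts)) :=
  fix loop t : K t := match t with
  | Node ts =>
    let fix iter_conj ts : foldr (fun t => and (K t)) True ts :=
      if ts is t :: ts' then conj (loop t) (iter_conj ts') else Logic.I
    in IH ts (iter_conj ts)
  end.

Fixpoint tree_encode (t : tree) : GenTree.tree void :=
  let: Node ts := t in GenTree.Node 0 (map tree_encode ts).

Fixpoint tree_decode (t : GenTree.tree void) : tree :=
  match t with
  | GenTree.Leaf x => match x with end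
  | GenTree.Node _ ts => Node (map tree_decode ts)
  end.

Lemma tree_encodeK : cancel tree_encode tree_decode.
Proof.
by elim=> ts IH /=; congr Node; elim: ts IH => //= t ts IHts [-> /IHts ->].
Qed.

HB.instance Definition _ := Countable.copy tree (can_type tree_encodeK).

Fixpoint nvert (t : tree) : nat :=
  let: Node ts := t in (sumn (map nvert ts)).+1.

(* N_d(t) *)
Fixpoint ndeg (d : nat) (t : tree) : nat :=
  let: Node ts := t in (size ts == d) + sumn (map (ndeg d) ts).

Definition ptree (m : nat) := {t : tree | nvert t == m}.

HB.instance Definition _ m := Countable.on (ptree m).

(* [forests fuel m] lists the forests with [m] vertices, provided
   [m <= fuel]; it only serves to equip [ptree m] with a [finType] structure. *)
Fixpoint forests (fuel m : nat) : seq (seq tree) :=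
  match fuel, m with
  | _, 0 => [:: [::]]
  | 0, _.+1 => [::]
  | fuel'.+1, m'.+1 =>
      flatten [seq [seq Node f1 :: f2 | f1 <- forests fuel' i,
                                        f2 <- forests fuel' (m' - i)]
              | i <- iota 0 m'.+1]
  end.

Lemma mem_forests fuel ts :
  sumn (map nvert ts) <= fuel -> ts \in forests fuel (sumn (map nvert ts)).
Proof.
elim: fuel ts => [|fuel IH] [|[f1] f2] //.
set s1 := sumn (map nvert f1); set s2 := sumn (map nvert f2).
have -> : sumn (map nvert (Node f1 :: f2)) = (s1 + s2).+1 by [].
rewrite ltnS => le_fuel; have le1 := leq_trans (leq_addr s2 s1) le_fuel.
have le2 := leq_trans (leq_addl s1 s2) le_fuel.
apply/flatten_mapP; exists s1; first by rewrite mem_iota /= add0n ltnS leq_addr.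
apply/allpairsP; exists (f1, f2); split=> //; first exact: IH.
by rewrite addKn; exact: IH.
Qed.

Definition ptree_enum (m : nat) : seq (ptree m) :=
  undup (pmap insub [seq Node f | f <- forests m m.-1]).

Lemma ptree_enumP m : Finite.axiom (ptree_enum m).
Proof.
apply: Finite.uniq_enumP => [|t]; first exact: undup_uniq.
rewrite mem_undup mem_pmap; apply/mapP; exists (val t); last by rewrite valK.
case: t => -[f] /= /eqP <-; rewrite map_f //.
by apply: mem_forests; rewrite /=; lia.
Qed.

HB.instance Definition _ m := isFinite.Build (ptree m) (@ptree_enumP m).

(* A vertex is addressed by the list of child ranks on the path from the root
   to it, and an edge by the address of its lower endpoint.  [contour t] lists
   the edges in the order in which the depth-first walk around [t] traverses
   them, so that each edge occurs twice: first downwards, then upwards.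
   In [contour_from c i ts], the trees [ts] are the children of rank [i],
   [i.+1], ... of a vertex. *)
Definition contour_from (c : tree -> seq (seq nat)) :=
  fix loop (i : nat) (ts : seq tree) : seq (seq nat) :=
    if ts is t :: ts' then
      ([:: i] :: rcons (map (cons i) (c t)) [:: i]) ++ loop i.+1 ts'
    else [::].

Fixpoint contour (t : tree) : seq (seq nat) :=
  let: Node ts := t in contour_from contour 0 ts.

Lemma size_contour t : size (contour t) = 2 * (nvert t).-1.
Proof.
elim: t => ts; rewrite [contour _]/= [(nvert _).-1]/=.
have [i ->] : exists i, contour_from contour 0 ts = contour_from contour i ts.
  by exists 0.
elim: ts i => //= t ts IHts i [IHt IH].
rewrite size_cat size_rcons size_map IHt IHts //.
by have : 0 < nvert t; [case: (t) | lia].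
Qed.

Definition well_paired (s : seq (seq nat)) :=
  (forall e, e \in s -> count_mem e s = 2) /\
  (forall i j k l, i < j -> j < k -> k < l -> l < size s ->
     nth [::] s i = nth [::] s k -> nth [::] s j = nth [::] s l -> False).

Lemma well_paired_cat (s1 s2 : seq (seq nat)) : well_paired s1 -> well_paired s2 ->
  (forall e, e \in s1 -> e \in s2 -> False) -> well_paired (s1 ++ s2).
Proof.
move=> [c1 x1] [c2 x2] dis; split=> [e|i j k l ij jk kl].
  rewrite mem_cat count_cat; case/orP => es.
    by rewrite (c1 e es) (count_memPn _) //; apply/negP; apply: dis es.
  by rewrite (c2 e es) (count_memPn _) //; apply/negP => /dis/(_ es).
rewrite size_cat => ls; rewrite !nth_cat.
have in1 a : a < size s1 -> nth [::] s1 a \in s1 by exact: mem_nth.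
have in2 a : size s1 <= a <= l -> nth [::] s2 (a - size s1) \in s2.
  case/andP=> sa al; apply: mem_nth; rewrite ltn_subLR //.
  exact: leq_ltn_trans al ls.
case: (ltnP i (size s1)) => hi; case: (ltnP k (size s1)) => hk.
- rewrite (_ : j < size s1); last lia.
  case: (ltnP l (size s1)) => hl; first exact: x1.
  move=> _ e; apply: (dis (nth [::] s1 j)); first by apply: in1; lia.
  by rewrite e; apply: in2; lia.
- move=> e _; apply: (dis (nth [::] s1 i)); first exact: in1.
  by rewrite e; apply: in2; lia.
- lia.
- rewrite !ltnNge (_ : size s1 <= j) /=; last lia.
  rewrite (_ : size s1 <= l) /=; last lia.
  by apply: x2; lia.
Qed.

Lemma well_paired_wrap (e : seq nat) (s : seq (seq nat)) :
  e \notin s -> well_paired s -> well_paired (e :: rcons s e).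
Proof.
move=> es [c x]; split=> [e'|i j k l ij jk kl].
  rewrite inE mem_rcons inE orbA orbb /= -cats1 count_cat /= addn0.
  case: (eqVneq e' e) => [->|ne] /=; first by rewrite (count_memPn es).
  by move=> e's; rewrite addn0 add0n c.
rewrite /= size_rcons => ls.
have ein a : a < size s -> nth [::] s a <> e.
  by move=> ha ea; case/negP: es; rewrite -ea mem_nth.
case: i j k l ij jk kl ls => [|i] [|j] [|k] [|l] //= ij jk kl ls;
  rewrite !nth_rcons.
  by rewrite (_ : k < size s); [move/esym/ein => H; case: H; lia | lia].
rewrite (_ : i < size s); last lia.
rewrite (_ : j < size s); last lia.
rewrite (_ : k < size s); last lia.
case: (ltnP l (size s)) => hl; first exact: x.
rewrite (_ : l == size s); last lia.
by move=> _ /ein; apply; lia.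
Qed.

Lemma well_paired_map (f : seq nat -> seq nat) (s : seq (seq nat)) :
  injective f -> well_paired s -> well_paired (map f s).
Proof.
move=> fI [c x]; split=> [_ /mapP[e es ->]|i j k l ij jk kl].
  rewrite count_map -(c e es); apply: eq_count => e' /=.
  by rewrite (inj_eq fI).
rewrite size_map => ls.
rewrite !(nth_map [::]); try lia.
by move=> /fI e1 /fI e2; apply: x e1 e2.
Qed.

Lemma contour_well_paired t : well_paired (contour t).
Proof.
suff [] : well_paired (contour t) /\ [::] \notin contour t by [].
elim: t => ts IH; rewrite [contour _]/=.
suff [P Q] : well_paired (contour_from contour 0 ts) /\
  (forall e, e \in contour_from contour 0 ts -> exists i e', e = i :: e' /\ 0 <= i).
  by split=> //; apply/negP => /Q[i [e' []]].
elim: ts 0 IH => /= [i _|t ts IHts i [[wt nt] /(IHts i.+1)[P Q]]].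
  by split=> //; split.
rewrite -cat_cons; set s1 := [:: i] :: rcons _ _.
set s2 := contour_from contour i.+1 ts.
have hd e : e \in s1 -> exists e', e = i :: e'.
  rewrite /s1 inE mem_rcons inE orbA orbb => /orP[/eqP ->|].
    by exists [::].
  by case/mapP => e' _ ->; exists e'.
split; last first.
  move=> e; rewrite mem_cat => /orP[/hd[e' ->]|/Q[j [e' [-> ij]]]].
    by exists i, e'.
  by exists j, e'; split=> //; lia.
apply: well_paired_cat => //; last first.
  by move=> e /hd[e' ->] /Q[j [e'' [[<-]]]]; lia.
apply: well_paired_wrap; last by apply: well_paired_map => // ? ? [].
by apply/negP => /mapP[e' e's [e0]]; rewrite -e0 in e's; rewrite e's in nt.
Qed.

(* The points 1, ..., 2n are represented by the ordinals 0, ..., 2n - 1. *)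
Definition pairing (m : nat) (P : {set {set 'I_m}}) : bool :=
  partition P [set: 'I_m] && [forall p in P, #|p| == 2].

Definition noncrossing (m : nat) (P : {set {set 'I_m}}) : bool :=
  ~~ [exists a : 'I_m, exists b : 'I_m, exists c : 'I_m, exists d : 'I_m,
      [&& a < b, b < c, c < d, [set a; c] \in P & [set b; d] \in P]].

Definition ncpairing (n : nat) :=
  {P : {set {set 'I_(2 * n)}} | pairing P && noncrossing P}.

Definition meander_system (n : nat) := (ncpairing n * ncpairing n)%type.

Definition meander_edge n (M : meander_system n) : rel 'I_(2 * n) :=
  fun a b => ([set a; b] \in val M.1) || ([set a; b] \in val M.2).

Lemma meander_connect_sym n (M : meander_system n) :
  connect_sym (meander_edge M).
Proof. by apply: sym_connect_sym => a b; rewrite /meander_edge setUC. Qed.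

Definition ncycles n (M : meander_system n) : nat :=
  n_comp (meander_edge M) predT.

(* The bijection beta: the step [a] goes down the edge that the step [b] goes
   up. *)
Definition contour_pairs n (t : ptree n.+1) : {set {set 'I_(2 * n)}} :=
  [set p | [exists a : 'I_(2 * n), exists b : 'I_(2 * n),
    [&& a < b, nth [::] (contour (val t)) a == nth [::] (contour (val t)) b
      & p == [set a; b]]]].

Section ContourPairs.
Variables (n : nat) (t : ptree n.+1).
Let s := contour (val t).
Let label (a : 'I_(2 * n)) := nth [::] s a.

Let size_s : size s = 2 * n.
Proof. by rewrite size_contour (eqP (valP t)). Qed.

Let card_label (a : 'I_(2 * n)) : #|[set b : 'I_(2 * n) | label b == label a]| = 2.
Proof.
have [c _] := contour_well_paired (val t).
transitivity (count_mem (label a) s); last first.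
  by apply: c; apply: mem_nth; rewrite -/s size_s.
rewrite -sum1_count (big_nth [::]) size_s big_mkord -sum1_card.
by apply: eq_bigl => b; rewrite inE.
Qed.

Let contour_pairsE (a b : 'I_(2 * n)) :
  ([set a; b] \in contour_pairs t) = (a != b) && (label a == label b).
Proof.
rewrite inE; apply/existsP/andP => [[c /existsP[d]]|[ab lab]].
  case/and3P=> cd /eqP lcd /eqP E.
  have nab : a != b.
    apply/eqP => ab; have: #|[set a; b]| = #|[set c; d]| by rewrite E.
    by rewrite !cards2 ab eqxx (_ : c != d) // neq_ltn cd.
  split=> //; have: a \in [set c; d] by rewrite -E !inE eqxx.
  have: b \in [set c; d] by rewrite -E !inE eqxx orbT.
  by rewrite !inE => /orP[]/eqP -> /orP[]/eqP ->; rewrite ?eqxx // /label lcd.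
case: (ltngtP a b) => [h|h|/val_inj h]; last by rewrite h eqxx in ab.
  by exists a; apply/existsP; exists b; rewrite h eqxx -/s lab.
by exists b; apply/existsP; exists a; rewrite h setUC eqxx -/s eq_sym lab.
Qed.

Let contour_pairs_preim : contour_pairs t = preim_partition label setT.
Proof.
have two (a : 'I_(2 * n)) :
    exists2 b, a != b & [set c in [set: 'I_(2 * n)] | label a == label c] = [set a; b].
  have /eqP/cards2P[x [y [xy E]]] := card_label a.
  have E' : [set c in [set: 'I_(2 * n)] | label a == label c] = [set x; y].
    by rewrite -E; apply/setP => c; rewrite !inE eq_sym.
  have: a \in [set x; y] by rewrite -E inE.
  rewrite !inE => /orP[]/eqP ea; first by exists y; rewrite ?E' ea.
  by exists x; rewrite ?E' ea 1?eq_sym // setUC.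
apply/setP => p; apply/idP/imsetP => [|[a _ ->]].
  rewrite inE => /existsP[a /existsP[b /and3P[ab /eqP lab /eqP ->]]].
  exists a => //.
  have [c ac E] := two a; rewrite E.
  have: b \in [set a; c] by rewrite -E !inE; apply/eqP.
  rewrite !inE => /orP[/eqP ba|/eqP -> //].
  by rewrite ba ltnn in ab.
have [b ab E] := two a; rewrite E contour_pairsE ab /=.
have: b \in [set a; b] by rewrite !inE eqxx orbT.
by rewrite -E !inE.
Qed.

Lemma contour_pairsP : pairing (contour_pairs t) && noncrossing (contour_pairs t).
Proof.
apply/andP; split.
  apply/andP; split; first by rewrite contour_pairs_preim preim_partitionP.
  apply/forall_inP => p; rewrite contour_pairs_preim => /imsetP[a _ ->].
  apply/eqP; rewrite -[RHS](card_label a); apply: eq_card => c.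
  by rewrite !inE eq_sym.
have [_ x] := contour_well_paired (val t).
apply/negP => /existsP[a /existsP[b /existsP[c /existsP[d]]]].
rewrite !contour_pairsE => /and5P[ab bc cd /andP[_ /eqP ac] /andP[_ /eqP bd]].
by apply: (x a b c d) => //; rewrite -/s size_s.
Qed.

End ContourPairs.

Definition contour_pairing n (t : ptree n.+1) : ncpairing n :=
  exist _ (contour_pairs t) (contour_pairsP t).

From mathcomp Require Import all_classical all_reals all_analysis.

Import Order.TTheory GRing.Theory Num.Theory.
Import numFieldNormedType.Exports.

Local Open Scope classical_set_scope.
Local Open Scope ring_scope.

Section SimplyGenerated.
Context {R : realType}.
Variable w : nat -> R.

(* The product over all [d] stops at [nvert t], since out-degrees are smaller
   than the number of vertices. *)
Definition tree_weight (t : tree) : R :=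
  \prod_(0 <= d < nvert t) w d ^+ ndeg d t.

Definition partition_function (m : nat) : R :=
  \sum_(t : ptree m) tree_weight (val t).

Definition sg_prob (m : nat) (t : ptree m) : R :=
  tree_weight (val t) / partition_function m.

(* Expected number of cycles of the system given by two independent simply
   generated trees on [n.+1] vertices, i.e. under the product of their laws. *)
Definition expected_ncycles (n : nat) : R :=
  \sum_(t : ptree n.+1) \sum_(t' : ptree n.+1)
    sg_prob t * sg_prob t' *
    (ncycles (contour_pairing t, contour_pairing t'))%:R.

Definition sg_radius : \bar R :=
  ereal_sup [set t%:E | t in [set t : R | 0 <= t /\ cvgn (pseries w t)]].

Definition sg_theta (t : R) : R := limn (pseries w t).

Definition sg_psi (t : R) : R := t * derive1 sg_theta t / sg_theta t.

(* Limit of [f] at [x] from the left; the value at [-oo] is irrelevant. *)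
Definition left_limit (f : R -> R) (x : \bar R) : \bar R :=
  match x with
  | r%:E => lim ((f t)%:E @[t --> r^'-])
  | +oo%E => lim ((f t)%:E @[t --> +oo])
  | -oo%E => -oo%E
  end.

(* Extension of a function on [[0, sg_radius[] to [[0, sg_radius]] by its left
   limit.  If the radius is 0 there is nothing to the left of it, and the
   value [f 0] is used. *)
Definition radius_ext (f : R -> R) (x : \bar R) : \bar R :=
  if (x == 0%E) || (x < sg_radius)%E then (f (fine x))%:E else left_limit f x.

Definition sg_tau : \bar R :=
  let sup_psi := ereal_sup [set (sg_psi t)%:E |
                   t in [set t : R | 0 <= t /\ (t%:E < sg_radius)%E]] in
  if (1 <= sup_psi)%E then
    ereal_inf [set x : \bar R | (0 <= x <= sg_radius)%E /\
                                radius_ext sg_psi x = 1%E]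
  else sg_radius.

(* The inverse of [+oo] is 0 in [\bar R], so this is 0 if theta(tau) = +oo. *)
Definition w0_over_theta_tau : R :=
  fine ((w 0)%:E / radius_ext sg_theta sg_tau)%E.

End SimplyGenerated.

(* Main.v *)
(** A leaf of a tree visited at the steps [a], [a + 1] gives the pair [{a, a + 1}];
    if both trees have a leaf there, [{a, a + 1}] is a cycle. If [p_a] is the
    probability of a leaf at [a], independence gives [E c(M_n) >= sum_a p_a^2], which
    by Cauchy-Schwarz is at least [(E N_0)^2 / 2n], so it suffices that
    [liminf E N_0 / n >= w_0 / theta(tau)].

    By the cycle lemma the degree sequence of a simply generated tree on [m] vertices
    is, up to order, a word of [m] letters with sum [m - 1], weighted by
    [prod_i w_(d_i)]. For two words [al], [be] of equal length and sum, exchanging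
    occurrences of [al] and [be] shows that the letter frequencies [q] satisfy
    [w(be) q(al) ~ w(al) q(be)] in mean square, the falling factorial moments agreeing
    exactly. A limit point of frequencies for which all these relations hold is
    [q_k = q_0 w_k t^k / w_0] for some [t], its mean is at most 1, whence [t <= tau]
    and [q_0 >= w_0 / theta(tau)]. No lower bound on the partition function, and
    hence no condition on [rho] or on the span of the weights, is needed. *)

Require Import Defs.
From HB Require Import structures.
From mathcomp Require Import all_boot all_order all_algebra zify ring lra.
From mathcomp Require Import all_classical all_reals all_analysis.
Import Order.TTheory GRing.Theory Num.Theory.
Import numFieldNormedType.Exports.
Local Open Scope classical_set_scope.
Local Open Scope ring_scope.

Set Implicit Arguments.
Unset Strict Implicit.
Unset Printing Implicit Defensive.

(** * The cycle lemma *)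

Definition perm_invariant (T : Type) (G : seq nat -> T) :=
  forall s s', perm_eq s s' -> G s = G s'.

Fixpoint words (N m : nat) : seq (seq nat) :=
  if m is m'.+1 then
    flatten [seq [seq d :: u | u <- words N m'] | d <- iota 0 N]
  else [:: [::]].

Lemma big_flatten_map (R : nmodType) (I J : Type) (r : seq I)
    (E : I -> seq J) (F : J -> R) :
  \sum_(x <- flatten [seq E i | i <- r]) F x = \sum_(i <- r) \sum_(x <- E i) F x.
Proof.
elim: r => [|i r IH] /=; first by rewrite !big_nil.
by rewrite big_cat big_cons IH.
Qed.

Lemma size_words N m v : v \in words N m -> size v = m.
Proof.
elim: m v => [|m IH] v /=; first by rewrite inE => /eqP ->.
by move=> /flatten_mapP[d _] /mapP[u /IH <- ->].
Qed.

Section Words.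
Variables (R : numFieldType) (N : nat).
Implicit Types (G H : seq nat -> R) (f : nat -> R).

Lemma sum_wordsS m H :
  \sum_(v <- words N m.+1) H v =
  \sum_(d <- iota 0 N) \sum_(u <- words N m) H (d :: u).
Proof.
rewrite [words _ _]/= big_flatten_map.
by apply: eq_bigr => d _; rewrite big_map.
Qed.

Lemma perm_invariant_cons G d : perm_invariant G -> perm_invariant (G \o cons d).
Proof. by move=> GP s s' ss' /=; apply: GP; rewrite perm_cons. Qed.

(* Mecke's formula for the positions of a word. *)
Lemma sum_words_letter m H f : perm_invariant H ->
  \sum_(v <- words N m) H v * (\sum_(i <- v) f i) =
  m%:R * \sum_(d <- iota 0 N) f d * \sum_(u <- words N m.-1) H (d :: u).
Proof.
elim: m H => [|m IH] H HP; first by rewrite big_seq1 big_nil mulr0 mul0r.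
rewrite sum_wordsS /=.
under eq_bigr => d _.
  under eq_bigr => u _ do rewrite big_cons mulrDr mulrC.
  rewrite big_split /= -mulr_sumr IH; last exact: perm_invariant_cons.
  over.
rewrite big_split /= -[in RHS]natr1 mulrDl mul1r addrC; congr (_ + _).
rewrite -mulr_sumr; case: m {IH} => [|m]; first by rewrite !mul0r.
congr (_ * _); rewrite exchange_big /=; apply: eq_bigr => d _.
rewrite -mulr_sumr sum_wordsS; congr (_ * _); apply: eq_bigr => e _.
by apply: eq_bigr => u _; apply: HP; apply/permP => a /=; rewrite addnCA.
Qed.

End Words.

(** The Lukasiewicz word of the tree: its out-degrees in preorder. *)
Fixpoint degrees (t : tree) : seq nat :=
  let: Node ts := t in size ts :: flatten (map degrees ts).

Definition forest_degrees (f : seq tree) := flatten (map degrees f).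

Lemma size_forest_degrees f : size (forest_degrees f) = sumn (map nvert f).
Proof.
have sizet t : size (degrees t) = nvert t.
  elim: t => ts /= IH; congr _.+1; elim: ts IH => //= t ts IHts [IHt IH].
  by rewrite size_cat IHt IHts.
by elim: f => //= t f IH; rewrite /forest_degrees /= size_cat sizet -IH.
Qed.

Lemma size_degrees t : size (degrees t) = nvert t.
Proof. by have := size_forest_degrees [:: t]; rewrite /forest_degrees /= cats0 addn0. Qed.

Lemma count_degrees d t : count_mem d (degrees t) = ndeg d t.
Proof.
elim: t => ts /= IH; congr (_ + _)%N; elim: ts IH => //= t ts IHts [IHt IH].
by rewrite count_cat IHt IHts.
Qed.

Lemma sumn_degrees t : (sumn (degrees t)).+1 = nvert t.
Proof.
elim: t => ts /= IH; congr _.+1.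
elim: ts IH => //= t ts IHts [IHt IH].
by have := IHts IH; rewrite sumn_cat; lia.
Qed.

(** Every vertex other than a root is a child of exactly one vertex. *)
Lemma sumn_forest_degrees f :
  (sumn (forest_degrees f) + size f = sumn (map nvert f))%N.
Proof.
elim: f => //= t f IH.
by rewrite /forest_degrees /= sumn_cat -(sumn_degrees t) -IH /forest_degrees; lia.
Qed.

(* The forests with [k] trees and [m] vertices, obtained by exposing the root of
   the first tree; [N] bounds the out-degrees. *)
Fixpoint kforests (N m k : nat) : seq (seq tree) :=
  match m, k with
  | 0, 0 => [:: [::]]
  | m'.+1, k'.+1 => flatten [seq [seq Node (take d f) :: drop d f
                                 | f <- kforests N m' (d + k')] | d <- iota 0 N]
  | _, _ => [::]
  end.

Lemma kforests_size N m k f : f \in kforests N m k ->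
  size f = k /\ sumn (map nvert f) = m.
Proof.
elim: m k f => [|m IH] [|k] f //=; first by rewrite inE => /eqP ->.
case/flatten_mapP => d _ /mapP[g /IH[sg ng] ->] /=.
rewrite size_drop sg; split; first by lia.
by rewrite -ng -{3}(cat_take_drop d g) map_cat sumn_cat.
Qed.

Lemma kforestsP N f : (sumn (map nvert f) <= N)%N ->
  f \in kforests N (sumn (map nvert f)) (size f).
Proof.
move e : (sumn _) => m; elim: m f e => [|m IH] [|[g] h] //= e leN.
have {}e : sumn (map nvert (g ++ h)) = m.
  by move: e; rewrite map_cat sumn_cat; lia.
apply/flatten_mapP; exists (size g).
  have := sumn_forest_degrees (g ++ h); rewrite e size_cat mem_iota; lia.
apply/mapP; exists (g ++ h); last by rewrite take_size_cat // drop_size_cat.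
by rewrite -size_cat; apply: IH => //; apply: ltnW.
Qed.

Lemma kforests_uniq N m k : uniq (kforests N m k).
Proof.
elim: m k => [|m IH] [|k] //.
apply: (@allpairs_uniq_dep _ (fun=> seq tree) _ (fun d f => Node (take d f) :: drop d f)).
- exact: iota_uniq.
- by move=> d _; exact: IH.
move=> [d f] [d' f'] /allpairsPdep[d1 [f1 [_ f1in [e1 e2]]]].
move=> /allpairsPdep[d2 [f2 [_ f2in [e3 e4]]]] /= [et ed].
subst d1 d2.
have ef : f = f1 by exact: e2.
have ef' : f' = f2 by exact: e4.
subst f1 f2.
have ff : f = f' by rewrite -(cat_take_drop d f) et ed cat_take_drop.
have [s1 _] := kforests_size f1in.
have [s2 _] := kforests_size f2in.
by move: s1 s2; rewrite -ff => -> /addIn ->.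
Qed.

Section CycleLemma.
Variables (R : numFieldType) (N : nat).
Implicit Types G : seq nat -> R.

Lemma sum_kforestsS m k G :
  \sum_(f <- kforests N m.+1 k.+1) G (forest_degrees f) =
  \sum_(d <- iota 0 N) \sum_(f <- kforests N m (d + k)) G (d :: forest_degrees f).
Proof.
rewrite [kforests _ _ _]/= big_flatten_map; apply: eq_bigr => d _.
rewrite big_map [LHS]big_seq [RHS]big_seq; apply: eq_bigr => f /kforests_size[sf _].
congr G; rewrite /forest_degrees /= size_take_min sf; congr (_ :: _); first by lia.
by rewrite -flatten_cat -map_cat cat_take_drop.
Qed.

(* The cycle lemma: a uniform average over words replaces the choice of the
   unique good rotation. *)
Lemma cycle_lemma m k G : perm_invariant G ->
  m%:R * \sum_(f <- kforests N m k) G (forest_degrees f) =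
  k%:R * \sum_(v <- words N m) (sumn v + k == m)%N%:R * G v.
Proof.
elim: m k G => [|m IH] [|k] G GP.
- by rewrite !mul0r.
- rewrite mul0r big1_seq ?mulr0 // => v /=; rewrite inE => /eqP ->.
  by rewrite mul0r.
- by rewrite mul0r big_nil mulr0.
rewrite sum_kforestsS.
(* The induction hypothesis carries the length of the remaining word as a factor, which must be
   nonzero to be cancelled; words of one letter are treated apart. *)
case: m IH => [|m] IH.
  rewrite sum_wordsS /= !mulr_sumr; apply: eq_bigr => d _; rewrite big_seq1 /=.
  case: d => [|d] /=.
    case: k {IH} => [|k]; rewrite ?big_seq1 ?big_nil ?mul1r /forest_degrees /= ?mul1r //.
    by rewrite mul0r mulr0.
  by rewrite big_nil mulr0 (_ : _ == _ = false) ?mul0r ?mulr0 //; apply/eqP; lia.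
apply: (@mulfI _ m.+1%:R); first by rewrite pnatr_eq0.
rewrite mulrCA [X in _ * X = _]mulr_sumr.
pose H v := (sumn v + k.+1 == m.+2)%N%:R * G v.
have HP : perm_invariant H by move=> s s' ss'; rewrite /H (perm_sumn ss') (GP s s').
have IHd d : m.+1%:R * \sum_(f <- kforests N m.+1 (d + k)) G (d :: forest_degrees f)
    = (d + k)%:R * (\sum_(u <- words N m.+1) H (d :: u)).
  rewrite (IH (d + k)%N (G \o cons d)); last exact: perm_invariant_cons.
  congr (_ * _); apply: eq_bigr => u _.
  by rewrite /H /=; congr ((_ : bool)%:R * _); apply/eqP/eqP; lia.
under eq_bigr => d _ do rewrite IHd.
(* The part with factor [d] is a mean first letter. By [sum_words_letter] it is the letter sum
   divided by [m.+2], and on the support of [H] that sum is [m.+1 - k]. *)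
have E : \sum_(d <- iota 0 N) (d + k)%:R * (\sum_(u <- words N m.+1) H (d :: u))
    = (\sum_(d <- iota 0 N) d%:R * (\sum_(u <- words N m.+1) H (d :: u))) +
       k%:R * \sum_(v <- words N m.+2) H v.
  rewrite (sum_wordsS _ m.+1) mulr_sumr -big_split /=; apply: eq_bigr => d _.
  by rewrite natrD mulrDl.
rewrite E mulrDr -(sum_words_letter _ _ (fun d => d%:R) HP).
have -> : \sum_(v <- words N m.+2) H v * (\sum_(i <- v) i%:R) =
   (m.+1%:R - k%:R) * \sum_(v <- words N m.+2) H v.
  rewrite mulr_sumr; apply: eq_bigr => v _; rewrite mulrC /H.
  have [/eqP e|] := boolP (sumn v + k.+1 == m.+2)%N; last by rewrite !mul0r !mulr0.
  congr (_ * _); rewrite -natr_sum -sumnE.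
  by rewrite (_ : m.+1 = sumn v + k)%N ?natrD ?addrK //; lia.
rewrite mulrA -mulrDl mulrA; congr (_ * _).
by rewrite -[m.+2]addn1 -[k.+1]addn1 !natrD; ring.
Qed.

(** The cycle lemma for a single tree; [N] exceeds every out-degree, so all trees are enumerated. *)
Lemma sum_ptree m G : perm_invariant G -> (m.+1 <= N)%N ->
  m.+1%:R * \sum_(t : ptree m.+1) G (degrees (val t)) =
  \sum_(v <- words N m.+1) (sumn v + 1 == m.+1)%N%:R * G v.
Proof.
move=> GP leN; rewrite -[RHS]mul1r -(cycle_lemma _ 1) //; congr (_ * _).
have -> : \sum_(t : ptree m.+1) G (degrees (val t)) =
   \sum_(f <- [seq [:: val t] | t <- index_enum (ptree m.+1)]) G (forest_degrees f).
  rewrite big_map; apply: eq_bigr => t _.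
  by rewrite /forest_degrees /= cats0.
apply: perm_big; apply: uniq_perm.
- rewrite map_inj_uniq; first exact: index_enum_uniq.
  by move=> t t' [] /val_inj.
- exact: kforests_uniq.
move=> f; apply/idP/idP => [/mapP[t _ ->]|fin].
  have := @kforestsP N [:: val t]; rewrite /= addn0 (eqP (valP t)); exact.
have [] := kforests_size fin; case: f {fin} => [|t []] //= _.
rewrite addn0 => /eqP tm; pose x : ptree m.+1 := exist _ t tm.
exact: (map_f (fun t : ptree m.+1 => [:: val t]) (mem_index_enum x)).
Qed.

End CycleLemma.

(** * Exchanging letters of a random word *)

Section Switching.
Variables (R : realFieldType) (N : nat) (w : nat -> R).
Hypothesis w_ge0 : forall i, 0 <= w i.
Implicit Types (G H : seq nat -> R) (al be v u : seq nat).

Definition word_weight v : R := \prod_(d <- v) w d.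

Definition letter_freq (v : seq nat) (d : nat) : R :=
  (count_mem d v)%:R / (size v)%:R.

Definition freq_monomial v al : R := \prod_(d <- al) letter_freq v d.

(** If the two words of [r] have equal length and sum, this expression vanishes at frequencies
    proportional to [w k * t ^+ k], for any [t]. *)
Definition switch_defect v (r : seq nat * seq nat) : R :=
  word_weight r.2 * freq_monomial v r.1 - word_weight r.1 * freq_monomial v r.2.

Lemma word_weight_ge0 v : 0 <= word_weight v.
Proof. exact: prodr_ge0. Qed.

Lemma word_weight_cat u v : word_weight (u ++ v) = word_weight u * word_weight v.
Proof. exact: big_cat. Qed.

Lemma freq_monomial_cat v al be :
  freq_monomial v (al ++ be) = freq_monomial v al * freq_monomial v be.
Proof. exact: big_cat. Qed.

Lemma letter_freq_bounds v d : 0 <= letter_freq v d <= 1.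
Proof.
rewrite divr_ge0 //=; case: v => [|a v]; first by rewrite /letter_freq invr0 mulr0.
by rewrite ler_pdivrMr ?ltr0n // mul1r ler_nat count_size.
Qed.

Lemma word_weight_perm : perm_invariant word_weight.
Proof. by move=> s s' ss'; exact: perm_big. Qed.

Lemma letter_freq_perm d : perm_invariant (letter_freq^~ d).
Proof.
by move=> s s' ss'; rewrite /letter_freq (permP ss') (perm_size ss').
Qed.

Lemma freq_monomial_perm al : perm_invariant (freq_monomial^~ al).
Proof.
by move=> s s' ss'; apply: eq_bigr => d _; exact: letter_freq_perm.
Qed.

(* With [acc = [::]], the number of ways of picking occurrences of the letters
   of [al] at pairwise distinct positions of [v]; [acc] records the letters
   already picked. *)
Fixpoint falling (acc al v : seq nat) : R :=
  if al is d :: al' then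
    ((count_mem d v)%:R - (count_mem d acc)%:R) * falling (d :: acc) al' v
  else 1.

Lemma falling_perm acc al : perm_invariant (falling acc al).
Proof.
move=> s s' ss'; elim: al acc => //= d al IH acc.
by rewrite (permP ss') IH.
Qed.

(** The extra [d] in the word cancels the extra [d] in the record. The record is taken up to
    permutation so that the induction can put further letters in front of [d]. *)
Lemma falling_cons d acc acc' al u : perm_eq acc' (d :: acc) ->
  falling acc' al (d :: u) = falling acc al u.
Proof.
elim: al acc acc' => //= e al IH acc acc' acc'P.
rewrite (permP acc'P) /= !natrD opprD addrACA subrr add0r; congr (_ * _).
apply: IH; apply: perm_trans (_ : perm_eq (e :: d :: acc) _).
  by rewrite perm_cons.
by apply/permP => a /=; rewrite addnCA.
Qed.

(** Mecke's formula iterated: once the positions carrying [al] are chosen, the other [m] letters are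
    free. The result depends on [al] only through its length, weight and sum, which is the exact
    exchange symmetry. *)
Lemma sum_words_falling m s al : {in al, forall d, (d < N)%N} ->
  \sum_(v <- words N (size al + m)) (sumn v == s)%:R * word_weight v * falling [::] al v =
  ((size al + m) ^_ (size al))%:R * word_weight al *
    \sum_(u <- words N m) (sumn al + sumn u == s)%N%:R * word_weight u.
Proof.
elim: al s => [|d al IH] s ltN /=.
  rewrite ffactn0 /word_weight big_nil mul1r mul1r; apply: eq_bigr => v _.
  by rewrite mulr1.
have dN : (d < N)%N by rewrite ltN ?mem_head.
pose H v := (sumn v == s)%:R * word_weight v * falling [:: d] al v.
have HP : perm_invariant H.
  by move=> v v' vv'; rewrite /H (perm_sumn vv') (word_weight_perm vv') (falling_perm _ _ vv').
transitivity (\sum_(v <- words N (size al + m).+1) H v * (\sum_(i <- v) (i == d)%:R)).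
  apply: eq_bigr => v _; rewrite -natr_sum -big_mkcond sum1_count subr0 /H.
  by ring.
rewrite sum_words_letter // [X in _ * X](bigD1_seq d) /= ?iota_uniq ?mem_iota //=.
rewrite [X in _ + X]big1; last by move=> e /negPf ->; rewrite mul0r.
rewrite eqxx mul1r addr0 addSn ffactnS /=.
pose s' := (s - d)%N; have [lt_sd|le_ds] := ltnP s d.
  rewrite [X in _ * X]big1_seq ?mulr0 => [|u _]; last first.
    by rewrite /H /= (_ : _ == s = false) ?mul0r //; apply/eqP; lia.
  rewrite big1_seq ?mulr0 // => u _.
  by rewrite (_ : _ == s = false) ?mul0r //; apply/eqP; lia.
transitivity ((size al + m).+1%:R * (w d * \sum_(u <- words N (size al + m))
   (sumn u == s')%:R * word_weight u * falling [::] al u)).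
  congr (_ * _); rewrite mulr_sumr; apply: eq_bigr => u _.
  rewrite /H (falling_cons _ _ (perm_refl _)) /word_weight big_cons /=.
  rewrite (_ : (d + sumn u == s)%N = (sumn u == s')) ; first by ring.
  by apply/eqP/eqP; rewrite /s'; lia.
rewrite IH => [|e eal]; last by rewrite ltN // inE eal orbT.
rewrite natrM /word_weight big_cons -!mulrA; congr (_ * _).
rewrite mulrCA; congr (_ * _); congr (_ * _); congr (_ * _).
apply: eq_bigr => u _; congr ((_ : bool)%:R * _).
by apply/eqP/eqP; rewrite /s'; lia.
Qed.

(** The products are compared factor by factor: corresponding factors have absolute value at most 1
    and differ by at most the length of the current record over [size v], so the errors add up. The
    first bound is carried along for the induction. *)
Lemma falling_approx acc al v : (size acc + size al <= size v)%N ->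
  `|falling acc al v / (size v)%:R ^+ size al| <= 1 /\
  `|freq_monomial v al - falling acc al v / (size v)%:R ^+ size al| <=
    (size al * (size acc + size al))%:R / (size v)%:R.
Proof.
set m : R := (size v)%:R.
elim: al acc => [|d al IH] acc /= le_m.
  by rewrite expr0 divr1 normr1 /freq_monomial big_nil subrr normr0 divr_ge0.
have m_gt0 : 0 < m by rewrite ltr0n; lia.
have [|IH1 IH2] := IH (d :: acc); first by rewrite /=; lia.
set F := falling _ _ _ in IH1 IH2 *.
rewrite exprS invfM mulrACA.
set a := (count_mem d acc)%:R / m.
have -> : ((count_mem d v)%:R - (count_mem d acc)%:R) / m = letter_freq v d - a.
  by rewrite mulrBl.
have /andP[x0 x1] := letter_freq_bounds v d.
have a0 : 0 <= a by rewrite divr_ge0 // ltW.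
have cacc := count_size (pred1 d) acc.
have a_le : a <= (size acc)%:R / m by rewrite ler_pM2r ?invr_gt0 // ler_nat.
have acc1 : (size acc)%:R / m <= 1 by rewrite ler_pdivrMr // mul1r ler_nat; lia.
have n1 : `|letter_freq v d - a| <= 1 by rewrite ler_norml; apply/andP; split; lra.
split; first by rewrite normrM mulr_ile1.
rewrite /freq_monomial big_cons -/(freq_monomial v al).
rewrite (_ : _ - _ = letter_freq v d * (freq_monomial v al - F / m ^+ size al)
   + a * (F / m ^+ size al)); last by ring.
apply: le_trans (ler_normD _ _) _; rewrite (normrM (letter_freq v d)) (normrM a) (ger0_norm x0) (ger0_norm a0).
apply: (@le_trans _ _ (((size al * (size (d :: acc) + size al))%:R / m)
    + (size acc)%:R / m)).
  apply: lerD; first by rewrite -[leRHS]mul1r ler_pM.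
  by rewrite -[leRHS]mulr1 ler_pM.
rewrite -mulrDl ler_pM2r ?invr_gt0 // -natrD ler_nat /=; nia.
Qed.

(** Expanding the square gives the monomials of [al ++ al], [al ++ be] and [be ++ be], words of one
    length and one sum. Their falling moments are the word weights times a common [g], so they
    cancel as [B ^+ 2 * A ^+ 2 - 2 * (A * B) * (A * B) + A ^+ 2 * B ^+ 2]. Only the error of
    [falling_approx], at most [K ^ 2 / m] per monomial, remains. *)
Lemma switching_variance (r : seq nat * seq nat) m s :
  size r.1 = size r.2 -> sumn r.1 = sumn r.2 ->
  {in r.1 ++ r.2, forall d, (d < N)%N} -> (size r.1 + size r.2 <= m)%N ->
  \sum_(v <- words N m) (sumn v == s)%:R * word_weight v * switch_defect v r ^+ 2 <=
  ((word_weight r.1 + word_weight r.2) ^+ 2 * ((size r.1 + size r.2) ^ 2)%:R / m%:R)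
  * \sum_(v <- words N m) (sumn v == s)%:R * word_weight v.
Proof.
case: r => al be /= es et ltN le_m.
set A := word_weight al; set B := word_weight be; set K := (_ + _)%N in le_m *.
have A0 : 0 <= A := word_weight_ge0 _; have B0 : 0 <= B := word_weight_ge0 _.
pose mu v := (sumn v == s)%:R * word_weight v.
have mu0 v : 0 <= mu v by rewrite mulr_ge0 // word_weight_ge0.
pose F ga v := falling [::] ga v / m%:R ^+ K.
pose c : R := ((K ^ 2)%:R / m%:R).
have Fapprox ga v : size ga = K -> v \in words N m ->
    `|freq_monomial v ga - F ga v| <= c.
  move=> sg /size_words sv.
  have [|_] := @falling_approx [::] ga v; first by rewrite sg sv.
  by rewrite sg sv add0n.
pose g := ((m ^_ K)%:R / m%:R ^+ K) *
    \sum_(u <- words N (m - K)) (sumn al + sumn al + sumn u == s)%N%:R * word_weight u.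
have Fsum ga : size ga = K -> {subset ga <= al ++ be} -> sumn ga = (sumn al + sumn al)%N ->
    \sum_(v <- words N m) mu v * F ga v = word_weight ga * g.
  move=> sg sub eg; under eq_bigr do rewrite /F mulrA; rewrite -mulr_suml.
  have := @sum_words_falling (m - K) s ga; rewrite sg subnKC // => -> => [|d /sub]; last exact: ltN.
  by rewrite eg /g; ring.
have Faa : \sum_(v <- words N m) mu v * F (al ++ al) v = A ^+ 2 * g.
  rewrite Fsum ?word_weight_cat -?expr2 // ?size_cat ?sumn_cat ?es //; rewrite /K ?es //.
  by move=> d; rewrite !mem_cat orbb => ->.
have Fab : \sum_(v <- words N m) mu v * F (al ++ be) v = A * B * g.
  by rewrite Fsum ?word_weight_cat // ?size_cat ?sumn_cat ?et.
have Fbb : \sum_(v <- words N m) mu v * F (be ++ be) v = B ^+ 2 * g.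
  rewrite Fsum ?word_weight_cat -?expr2 // ?size_cat ?sumn_cat ?et //; rewrite /K ?es //.
  by move=> d; rewrite !mem_cat orbb => ->; rewrite orbT.
pose D v := B ^+ 2 * F (al ++ al) v - 2 * (A * B) * F (al ++ be) v + A ^+ 2 * F (be ++ be) v.
have D0 : \sum_(v <- words N m) mu v * D v = 0.
  rewrite (_ : \sum_(v <- _) _ = B ^+ 2 * (A ^+ 2 * g) - 2 * (A * B) * (A * B * g)
      + A ^+ 2 * (B ^+ 2 * g)); first by ring.
  rewrite -Faa -Fab -Fbb !mulr_sumr -sumrB -big_split /=.
  by apply: eq_bigr => v _; rewrite /D; ring.
rewrite -[leLHS]subr0 -[X in _ - X]D0 -sumrB mulr_sumr big_seq [leRHS]big_seq; apply: ler_sum => v vin.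
rewrite -/(mu v) -mulrBr mulrC; apply: ler_wpM2r => //.
have /(_ (al ++ al)) := Fapprox _ v _ vin.
have /(_ (al ++ be)) := Fapprox _ v _ vin.
have /(_ (be ++ be)) := Fapprox _ v _ vin.
rewrite !size_cat !freq_monomial_cat /switch_defect /= -/A -/B /D.
set x := freq_monomial v al; set y := freq_monomial v be.
set f1 := F _ _; set f2 := F _ _; set f3 := F _ _.
rewrite !ler_norml; rewrite /K es => /(_ erefl)/andP[h1 h1'] /(_ erefl)/andP[h2 h2'] /(_ erefl)/andP[h3 h3'].
rewrite (_ : _ - _ = B ^+ 2 * (x * x - f3) - 2 * (A * B) * (x * y - f2)
  + A ^+ 2 * (y * y - f1)); last by ring.
rewrite [leRHS](_ : _ = B ^+ 2 * c + 2 * (A * B) * c + A ^+ 2 * c); last by rewrite /c /K es; ring.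
have AB0 : 0 <= 2 * (A * B) by rewrite !mulr_ge0.
apply: lerD; last by rewrite ler_wpM2l ?sqr_ge0.
apply: lerD; first by rewrite ler_wpM2l ?sqr_ge0.
by rewrite -mulrN ler_wpM2l // lerNl.
Qed.

End Switching.

(** * The generating function and its critical parameter *)

Section PowerSeries.
Variable R : realType.
Implicit Types (f : nat -> R) (s t r : R).

Lemma pseries_nondecreasing f t :
  (forall i, 0 <= f i) -> 0 <= t -> nondecreasing_seq (pseries f t).
Proof.
by move=> f0 t0; apply: nondecreasing_series => n _ _; rewrite mulr_ge0 ?exprn_ge0.
Qed.

Lemma pseries_bounded_cvg f t M : (forall i, 0 <= f i) -> 0 <= t ->
  (forall n, pseries f t n <= M) -> cvgn (pseries f t).
Proof.
move=> f0 t0 ub; apply: nondecreasing_is_cvgn; first exact: pseries_nondecreasing.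
by exists M => _ [n _ <-].
Qed.

Lemma pseries_le_lim f t n : (forall i, 0 <= f i) -> 0 <= t ->
  cvgn (pseries f t) -> pseries f t n <= limn (pseries f t).
Proof. by move=> f0 t0 cv; apply: nondecreasing_cvgn_le => //; exact: pseries_nondecreasing. Qed.

Lemma pseries_le f s t n : (forall i, 0 <= f i) -> 0 <= s -> s <= t ->
  pseries f s n <= pseries f t n.
Proof.
move=> f0 s0 st; apply: ler_sum => i _.
by rewrite ler_wpM2l // lerXn2r // nnegrE (le_trans s0).
Qed.

Lemma is_cvg_pseries_le f s t : (forall i, 0 <= f i) -> 0 <= s -> s <= t ->
  cvgn (pseries f t) -> cvgn (pseries f s).
Proof.
move=> f0 s0 st cv; apply: (@pseries_bounded_cvg _ _ (limn (pseries f t))) => // n.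
apply: le_trans (pseries_le _ _ s0 st) _ => //.
by apply: pseries_le_lim => //; apply: le_trans st.
Qed.

(* [(i + 1) s^i (t - s) <= t^(i + 1) - s^(i + 1)] *)
Lemma is_cvg_pseries_diffs f s t : (forall i, 0 <= f i) -> 0 <= s -> s < t ->
  cvgn (pseries f t) -> cvgn (pseries (pseries_diffs f) s).
Proof.
move=> f0 s0 st cv; have t0 : 0 <= t := le_trans s0 (ltW st).
apply: (@pseries_bounded_cvg _ _ (limn (pseries f t) / (t - s))) => // [i|n].
  by rewrite mulr_ge0.
rewrite ler_pdivlMr ?subr_gt0 //.
apply: le_trans (pseries_le_lim n.+1 f0 t0 cv).
rewrite /pseries /series /= big_nat_recl // mulr_suml.
rewrite -[leLHS]add0r lerD ?mulr_ge0 //; apply: ler_sum => i _.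
rewrite /pseries_diffs mulrAC -!mulrA mulrCA ler_wpM2l //.
apply: (@le_trans _ _ (t ^+ i.+1 - s ^+ i.+1)); last first.
  by rewrite lerBlDr lerDl exprn_ge0.
rewrite subrXX mulrCA ler_wpM2l ?subr_ge0 ?(ltW st) //.
rewrite -[i.+1 in leLHS]card_ord mulr_natl -sumr_const; apply: ler_sum => j _.
rewrite -[X in s ^+ X](subnK (_ : (j <= i)%N)); last by have := ltn_ord j; lia.
by rewrite exprD ler_wpM2r ?exprn_ge0 // lerXn2r // ltW.
Qed.

Lemma pseries_diffs_ge0 f : (forall i, 0 <= f i) -> forall i, 0 <= pseries_diffs f i.
Proof. by move=> f0 i; rewrite mulr_ge0. Qed.

Lemma is_derive_pseries f s r : (forall i, 0 <= f i) -> 0 <= s -> s < r ->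
  cvgn (pseries f r) ->
  is_derive s 1 (fun x => limn (pseries f x)) (limn (pseries (pseries_diffs f) s)).
Proof.
move=> f0 s0 sr cv.
(* Each differentiation costs some room: the series converges at [r], its derivative at [K1 < r],
   its second derivative at [K < K1]. *)
pose K1 := (s + r) / 2; pose K := (s + K1) / 2.
have sK : s < K by rewrite /K /K1; lra.
have K0 : 0 <= K by lra.
have KK1 : K < K1 by rewrite /K /K1 in sK *; lra.
have K1r : K1 < r by rewrite /K /K1 in sK *; lra.
have c1 := is_cvg_pseries_diffs f0 (le_trans K0 (ltW KK1)) K1r cv.
apply: (@pseries_snd_diffs _ f K).
- exact: is_cvg_pseries_le f0 K0 (ltW (lt_trans KK1 K1r)) cv.
- exact: is_cvg_pseries_diffs f0 K0 (lt_trans KK1 K1r) cv.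
- exact: is_cvg_pseries_diffs (pseries_diffs_ge0 f0) K0 KK1 c1.
by rewrite !ger0_norm.
Qed.

End PowerSeries.

(** * The critical parameter tau and the value theta(tau) *)

Section CriticalParameter.
Variables (R : realType) (w : nat -> R).
Hypotheses (w0_gt0 : 0 < w 0%N) (w_ge0 : forall i, 0 <= w i).
Implicit Types s t r : R.

Let theta := sg_theta w.
Let dtheta t : R := limn (pseries (pseries_diffs w) t).
Let rho := sg_radius w.

(** Partial sums of t theta'(t) - theta(t), which has the sign of psi(t) - 1. Unlike psi, they make
    sense without convergence. *)
Definition drift t (n : nat) : R := \sum_(0 <= k < n) (k%:R - 1) * w k * t ^+ k.

Lemma lt_radius_cvg s : (s%:E < rho)%E -> exists2 r, s < r & cvgn (pseries w r).
Proof.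
by move=> /ereal_sup_gt[_ [r [r0 cv] <-]]; rewrite lte_fin => sr; exists r.
Qed.

Lemma cvg_le_radius t : 0 <= t -> cvgn (pseries w t) -> (t%:E <= rho)%E.
Proof. by move=> t0 cv; apply: ereal_sup_ubound; exists t. Qed.

Lemma is_cvg_theta s : 0 <= s -> (s%:E < rho)%E -> cvgn (pseries w s).
Proof.
by move=> s0 /lt_radius_cvg[r sr]; apply: is_cvg_pseries_le => //; exact: ltW.
Qed.

Lemma is_cvg_dtheta s : 0 <= s -> (s%:E < rho)%E -> cvgn (pseries (pseries_diffs w) s).
Proof. by move=> s0 /lt_radius_cvg[r sr]; exact: is_cvg_pseries_diffs. Qed.

Lemma is_derive_theta s : 0 <= s -> (s%:E < rho)%E -> is_derive s 1 theta (dtheta s).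
Proof. by move=> s0 /lt_radius_cvg[r sr]; exact: is_derive_pseries. Qed.

Lemma continuous_dtheta s : 0 <= s -> (s%:E < rho)%E -> {for s, continuous dtheta}.
Proof.
move=> s0 /lt_radius_cvg[r sr cv].
pose r' := (s + r) / 2; have sr' : s < r' by rewrite /r'; lra.
have r'r : r' < r by rewrite /r'; lra.
have r'0 : 0 <= r' by lra.
have := is_derive_pseries (pseries_diffs_ge0 w_ge0) s0 sr'
  (is_cvg_pseries_diffs w_ge0 r'0 r'r cv).
by case=> /derivable1_diffP/differentiable_continuous.
Qed.

Lemma continuous_theta s : 0 <= s -> (s%:E < rho)%E -> {for s, continuous theta}.
Proof.
by move=> s0 sr; have [/derivable1_diffP/differentiable_continuous] := is_derive_theta s0 sr.
Qed.

Lemma theta_ge n s : 0 <= s -> cvgn (pseries w s) -> pseries w s n <= theta s.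
Proof. by move=> s0; exact: pseries_le_lim. Qed.

Lemma theta_ge_w0 s : 0 <= s -> cvgn (pseries w s) -> w 0%N <= theta s.
Proof.
move=> s0 cv; apply: le_trans (theta_ge 1 s0 cv).
by rewrite /pseries /series /= big_nat1 mulr1.
Qed.

Lemma theta_le s t : 0 <= s -> s <= t -> cvgn (pseries w t) -> theta s <= theta t.
Proof.
move=> s0 st cv; apply: limr_le; first exact: is_cvg_pseries_le s0 st cv.
near=> n; apply: le_trans (pseries_le n w_ge0 s0 st) _.
by apply: theta_ge cv; apply: le_trans st.
Unshelve. all: by end_near. Qed.

Let excess s := s * dtheta s - theta s.

Lemma drift_cvg s : 0 <= s -> (s%:E < rho)%E -> drift s n @[n --> \oo] --> excess s.
Proof.
move=> s0 sr; rewrite -(cvg_shiftS (drift s)) /=.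
have -> : (fun n => drift s n.+1) = (fun n => s * pseries (pseries_diffs w) s n - pseries w s n.+1).
  apply/funext => n; rewrite /drift /pseries /series /= mulr_sumr.
  under eq_bigr do rewrite mulrBl mul1r mulrBl.
  rewrite sumrB; congr (_ - _); rewrite big_nat_recl // !mul0r add0r.
  by apply: eq_bigr => i _; rewrite /pseries_diffs exprS; ring.
apply: cvgB; first by apply: cvgZr; exact: is_cvg_dtheta.
by rewrite (cvg_shiftS (pseries w s)); exact: is_cvg_theta.
Qed.

Lemma psi_excess s : 0 <= s -> (s%:E < rho)%E -> sg_psi w s - 1 = excess s / theta s.
Proof.
move=> s0 sr; have [_ d] := is_derive_theta s0 sr.
have th0 : theta s != 0.
  by rewrite gt_eqF // (lt_le_trans w0_gt0) // theta_ge_w0 //; exact: is_cvg_theta.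
rewrite /sg_psi -/theta derive1E d /excess mulrBl divff //.
Qed.


(** The only negative coefficient is that of the constant term. *)
Lemma drift_le s t n : 0 <= s -> s <= t -> drift s n <= drift t n.
Proof.
move=> s0 st; apply: ler_sum => -[|k] _; first by rewrite !expr0.
by rewrite ler_wpM2l ?mulr_ge0 ?subr_ge0 ?ler1n // lerXn2r // nnegrE (le_trans s0).
Qed.

Lemma excess_le s t : 0 <= s -> s <= t -> (t%:E < rho)%E -> excess s <= excess t.
Proof.
move=> s0 st tr; have sr : (s%:E < rho)%E by apply: le_lt_trans tr; rewrite lee_fin.
have cs := drift_cvg s0 sr; have ct := drift_cvg (le_trans s0 st) tr.
apply: ler_cvg_to cs ct _; near=> n; exact: drift_le.
Unshelve. all: by end_near. Qed.

(** From [k = 2] on, the coefficient [k - 1] is at least 1; the added terms compensate for [k = 0]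
    and [k = 1]. Thus a bound on the drift bounds the series itself. *)
Lemma pseries_le_drift s n : 0 <= s ->
  pseries w s n <= 2 * w 0%N + w 1%N * s + drift s n.
Proof.
move=> s0; rewrite /pseries /series /drift /=.
case: n => [|n]; first by rewrite !big_geq // addr0 addr_ge0 ?mulr_ge0.
case: n => [|n]; first by rewrite !big_nat1; have := mulr_ge0 (w_ge0 1) s0; lra.
rewrite !(big_nat_recl n.+1) // !(big_nat_recl n) //= subrr !mul0r.
have : \sum_(0 <= i < n) w i.+2 * s ^+ i.+2 <= \sum_(0 <= i < n) (i.+2%:R - 1) * w i.+2 * s ^+ i.+2.
  apply: ler_sum => i _; rewrite -mulrA -[leLHS]mul1r.
  apply: ler_wpM2r; first by rewrite mulr_ge0 // exprn_ge0.
  by rewrite lerBrDr -natr1 lerD2r ler1n.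
set A := \sum_(_ <= _ < _) _; set B := \sum_(_ <= _ < _) _.
by rewrite expr0 expr1; lra.
Qed.

Lemma theta_le_excess s : 0 <= s -> (s%:E < rho)%E ->
  theta s <= 2 * w 0%N + w 1%N * s + excess s.
Proof.
move=> s0 sr; have cv := is_cvg_theta s0 sr.
apply: ler_cvg_to cv (cvgD (cvg_cst _) (drift_cvg s0 sr)) _.
by near=> n; exact: pseries_le_drift.
Unshelve. all: by end_near. Qed.

(** The left limit exists because theta is nondecreasing, and theta dominates each partial sum,
    which is a continuous polynomial. *)
Lemma left_limit_theta_ge s n : 0 <= s -> (s%:E <= rho)%E -> rho != 0%E ->
  ((pseries w s n)%:E <= left_limit theta rho)%E.
Proof.
move=> s0; have := @is_cvg_theta; case: rho => [r| |] //= cvth.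
- rewrite lee_fin eqe => sr r_neq0.
  have r0 : 0 < r by rewrite lt_neqAle eq_sym r_neq0 (le_trans s0 sr).
  have cvL : cvg ((theta x)%:E @[x --> r^'-]).
    suff : (theta x)%:E @[x --> r^'-] -->
      ereal_sup ((fun x => (theta (- x))%:E) @` [set` Interval (BRight (- r)) (BLeft 0)]).
      exact: cvgP.
    apply/cvg_at_leftNP; apply: nonincreasing_at_right_cvge; first by rewrite bnd_simp oppr_lt0.
    move=> x y /=; rewrite !in_itv /= => /andP[rx x0] /andP[ry y0] xy.
    rewrite lee_fin; apply: theta_le; rewrite ?lerN2 //; first by lra.
    by apply: cvth; rewrite ?lte_fin; lra.
  apply: (@le_trans _ _ (pseries w r n)%:E); first by rewrite lee_fin; exact: pseries_le.
  have cvP : (pseries w x n)%:E @[x --> r^'-] --> (pseries w r n)%:E.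
    apply: cvg_EFin; first exact: nearW.
    apply: (@cvg_at_left_filter _ _ (fun x => pseries w x n)).
    apply: (@cvg_big _ _ _ _ _ (@add_continuous _)) => i _.
    by apply: cvgZr; exact: exprn_continuous.
  apply: (lee_cvg_to cvP cvL); near=> x; rewrite lee_fin.
  have x0 : 0 < x by near: x; exact: nbhs_left_gt.
  apply: theta_ge; first exact: ltW.
  by apply: cvth; rewrite ?ltW // lte_fin; near: x; exact: nbhs_left_lt.
(* Monotonicity of theta is known on nonnegative arguments only, hence the truncation at 0. *)
- move=> _ _; set g := fun x => (theta (Num.max 0 x))%:E.
  have cvg_g : g x @[x --> +oo] --> ereal_sup (range g).
    apply: nondecreasing_cvge => x y xy; rewrite lee_fin; apply: theta_le.
    - by rewrite le_max lexx.
    - by rewrite ge_max !le_max lexx /= xy orbT.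
    - by apply: cvth; rewrite ?ltry // le_max lexx.
  have cvL : (theta x)%:E @[x --> +oo] --> ereal_sup (range g).
    apply: cvg_trans cvg_g; apply: near_eq_cvg; near=> x.
    rewrite /g max_r //; near: x; exact: nbhs_pinfty_ge.
  rewrite (cvg_lim _ cvL) //; apply: ereal_sup_ge; exists (g s); first by exists s.
  by rewrite lee_fin max_r // theta_ge //; apply: cvth => //; exact: ltry.
Unshelve. all: by end_near. Qed.

Section Subcritical.
Variable t : R.
Hypotheses (t_ge0 : 0 <= t) (drift_t : forall n, drift t n <= 0).

Lemma subcritical_cvg : cvgn (pseries w t).
Proof.
apply: (@pseries_bounded_cvg _ _ _ (2 * w 0%N + w 1%N * t)) => // n.
by apply: le_trans (pseries_le_drift n t_ge0) _; rewrite gerDl.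
Qed.

Lemma subcritical_le_radius : (t%:E <= rho)%E.
Proof. exact: cvg_le_radius subcritical_cvg. Qed.

(** Passing from [t] to [s] keeps the constant term [- w 0] and multiplies the terms with [k >= 2]
    by at most [(s / t) ^+ 2], the term [k = 1] being zero. Hence the limit drift at [s] is at most
    [w 0 * ((s / t) ^+ 2 - 1) < 0]. *)
Lemma subcritical_psi s : 0 <= s -> s < t -> sg_psi w s < 1.
Proof.
move=> s0 st; have sr : (s%:E < rho)%E.
  by apply: lt_le_trans subcritical_le_radius; rewrite lte_fin.
have t0 : 0 < t by apply: le_lt_trans st.
suff : excess s < 0.
  move=> e0; rewrite -subr_lt0 psi_excess // pmulr_llt0 // invr_gt0.
  by rewrite (lt_le_trans w0_gt0) // theta_ge_w0 //; exact: is_cvg_theta.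
apply: (@le_lt_trans _ _ (w 0%N * (s ^+ 2 / t ^+ 2 - 1))); last first.
  rewrite pmulr_rlt0 // subr_lt0 ltr_pdivrMr ?exprn_gt0 // mul1r.
  by rewrite ltrXn2r // nnegrE ltW.
apply: cvgr_to_le (drift_cvg s0 sr) _; near=> n.
have n0 : (0 < n)%N by near: n; exact: nbhs_infty_gt.
rewrite -(prednK n0); have := drift_t n.-1.+1; rewrite /drift !big_nat_recl // !sub0r !expr0 !mulr1 !mulN1r.
set A := \sum_(_ <= _ < _) _ => A_le; set B := \sum_(_ <= _ < _) _.
suff : B <= s ^+ 2 / t ^+ 2 * A.
  have q0 : 0 <= s ^+ 2 / t ^+ 2 by rewrite divr_ge0 ?sqr_ge0.
  have : s ^+ 2 / t ^+ 2 * A <= s ^+ 2 / t ^+ 2 * w 0%N by rewrite ler_wpM2l //; lra.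
  by lra.
rewrite mulr_sumr; apply: ler_sum => -[|i] _; first by rewrite subrr !mul0r mulr0.
rewrite [leRHS]mulrCA; apply: ler_wpM2l; first by rewrite mulr_ge0 ?subr_ge0 ?ler1n.
rewrite (exprD s 2 i) (exprD t 2 i) mulrA divfK ?expf_neq0 ?gt_eqF //.
by rewrite ler_wpM2l ?exprn_ge0 // lerXn2r // ?nnegrE // ltW.
Unshelve. all: by end_near. Qed.


Lemma tau_ge : (t%:E <= sg_tau w)%E.
Proof.
rewrite /sg_tau; case: ifP => _; last exact: subcritical_le_radius.
apply: le_ereal_inf_tmp => x [/andP[x0 xr] psi1]; rewrite leNgt; apply/negP => xt.
case: x x0 xr psi1 xt => [x| |] //; rewrite lee_fin lte_fin => x0 xr + xt.
rewrite /radius_ext (lt_le_trans _ subcritical_le_radius) ?lte_fin ?orbT //=.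
by move=> [] /eqP; rewrite lt_eqF // subcritical_psi.
Qed.

Let sup_psi := ereal_sup [set (sg_psi w s)%:E | s in [set s | 0 <= s /\ (s%:E < rho)%E]].

(** Here psi - 1 is [excess / theta], where [excess] is negative and nondecreasing and theta lies
    between [w 0] and [B]. So psi close to 1 at one point [s] forces [excess] close to 0, and psi
    close to 1, on all of [[s, r[]. *)
Lemma psi_left_limit r : rho = r%:E -> (1 <= sup_psi)%E ->
  (forall s, 0 <= s -> s < r -> sg_psi w s < 1) ->
  (sg_psi w s)%:E @[s --> r^'-] --> 1%E.
Proof.
move=> rhoE sup1 psi_lt1; apply: cvg_EFin; first exact: nearW.
have thr s : s < r -> (s%:E < rho)%E by rewrite rhoE lte_fin.
have th_gt0 s : 0 <= s -> s < r -> 0 < theta s.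
  by move=> s0 /thr sr; rewrite (lt_le_trans w0_gt0) // theta_ge_w0 //; exact: is_cvg_theta.
have excess_lt0 s : 0 <= s -> s < r -> excess s < 0.
  move=> s0 sr; have := psi_lt1 s s0 sr; rewrite -subr_lt0 psi_excess ?thr //.
  by rewrite pmulr_llt0 // invr_gt0 th_gt0.
have r_ge0 : 0 <= r by rewrite -lee_fin -rhoE; exact: le_trans subcritical_le_radius.
pose B := 2 * w 0%N + w 1%N * r.
have B_gt0 : 0 < B by rewrite ltr_pwDl ?mulr_gt0 // mulr_ge0.
have theta_leB s : 0 <= s -> s < r -> theta s <= B.
  move=> s0 sr; apply: le_trans (theta_le_excess s0 (thr _ sr)) _.
  have := excess_lt0 s s0 sr; have : w 1%N * s <= w 1%N * r by rewrite ler_wpM2l // ltW.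
  by rewrite /B; lra.
apply/cvgrPdist_le => e e0.
(* The threshold [e * w 0 / B] becomes [e * w 0] when multiplied by theta at [s], and [e] when
   divided by theta at [x]. *)
have [_ [s [s0 sr] <-]] : exists2 y, [set (sg_psi w s)%:E | s in [set s | 0 <= s /\ (s%:E < rho)%E]] y
    & ((1 - e * w 0%N / B)%:E < y)%E.
  apply: ereal_sup_gt; apply: lt_le_trans sup1.
  by rewrite lte_fin gtrDl oppr_lt0 divr_gt0 ?mulr_gt0.
rewrite lte_fin ltrBlDr -ltrBlDl => psi_s.
have {}sr : s < r by move: sr; rewrite rhoE lte_fin.
have exs : - (e * w 0%N) <= excess s.
  move: psi_s; rewrite -opprB psi_excess ?thr // => psi_s.
  have : - excess s <= e * w 0%N / B * theta s.
    by rewrite -ler_pdivrMr ?th_gt0 // mulNr ltW.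
  have : e * w 0%N / B * theta s <= e * w 0%N.
    by rewrite mulrAC ler_pdivrMr // ler_wpM2l ?theta_leB // mulr_ge0 // ltW.
  by lra.
near=> x.
have sx : s < x by near: x; exact: nbhs_left_gt.
have xr : x < r by near: x; exact: nbhs_left_lt.
have x0 : 0 <= x := le_trans s0 (ltW sx).
rewrite ger0_norm; last by rewrite subr_ge0 ltW // psi_lt1.
rewrite -opprB psi_excess ?thr // -mulNr ler_pdivrMr ?th_gt0 //.
apply: (@le_trans _ _ (e * w 0%N)).
  have := excess_le s0 (ltW sx) (thr _ xr); lra.
by rewrite ler_wpM2l ?(ltW e0) // theta_ge_w0 //; apply: is_cvg_theta => //; exact: thr.
Unshelve. all: by end_near. Qed.

(** The infimum defining tau would be [+oo] over an empty set, so for a finite radius a solution of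
    psi = 1 has to be exhibited: a zero of [excess] by the intermediate value theorem, or the radius
    itself if psi stays below 1. *)
Lemma tau_le_radius : (sg_tau w <= rho)%E.
Proof.
rewrite /sg_tau -/sup_psi; case: ifP => // sup1.
have [->|[r rhoE]] : rho = +oo%E \/ exists r, rho = r%:E.
- by have := subcritical_le_radius; case: rho => [r| |] //; [right; exists r|left].
- exact: leey.
have thr s : s < r -> (s%:E < rho)%E by rewrite rhoE lte_fin.
have r_ge0 : 0 <= r by rewrite -lee_fin -rhoE; exact: le_trans subcritical_le_radius.
suff [x [x0 xr psix]] : exists x, [/\ 0 <= x, x <= r & radius_ext w (sg_psi w) x%:E = 1%E].
  apply: (@le_trans _ _ x%:E); last by rewrite rhoE lee_fin.
  by apply: ereal_inf_lbound; split=> //; rewrite -/rho rhoE !lee_fin x0.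
have [[s [s0 sr psi_s]]|none] := pselect (exists s, [/\ 0 <= s, s < r & 1 <= sg_psi w s]).
  have th_gt0 x : 0 <= x -> x < r -> 0 < theta x.
    by move=> x0 /thr xr; rewrite (lt_le_trans w0_gt0) // theta_ge_w0 //; exact: is_cvg_theta.
  have ex0 : excess 0 <= 0.
    by rewrite /excess mul0r sub0r oppr_le0 ltW // th_gt0 // (le_lt_trans s0).
  have exs : 0 <= excess s.
    move: psi_s; rewrite -subr_ge0 psi_excess ?thr // pmulr_lge0 //.
    by rewrite invr_gt0 th_gt0.
  have cont : {within `[0, s], continuous excess}.
    apply: continuous_in_subspaceT => x; rewrite inE /= in_itv /= => /andP[x0 xs].
    have xr : (x%:E < rho)%E by apply: thr; exact: le_lt_trans sr.
    apply: cvgB; last exact: continuous_theta.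
    by apply: cvgM; [exact: cvg_id | exact: continuous_dtheta].
  have [|x /[!in_itv]/= /andP[x0 xs] exx] := IVT s0 cont (v := 0).
    by rewrite ge_min le_max ex0 exs orbT.
  have xr : x < r by exact: le_lt_trans sr.
  exists x; split=> //; first exact: ltW.
  rewrite /radius_ext -/rho thr // orbT /=; congr EFin.
  by apply/eqP; rewrite -subr_eq0 psi_excess ?thr // exx mul0r.
have psi_lt1 s : 0 <= s -> s < r -> sg_psi w s < 1.
  by move=> s0 sr; rewrite ltNge; apply/negP => h; apply: none; exists s.
have r_neq0 : r != 0.
  apply/eqP => r0; move: sup1; rewrite /sup_psi rhoE r0.
  rewrite (_ : [set s | _] = set0) ?image_set0 ?ereal_sup0 //.
  by apply/seteqP; split=> // s [s0]; rewrite lte_fin ltNge s0.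
exists r; split=> //.
rewrite /radius_ext -/rho rhoE ltxx eqe (negPf r_neq0) /=.
by apply: cvg_lim => //; exact: psi_left_limit.
Qed.

Lemma subcritical_le_theta_tau n :
  ((pseries w t n)%:E <= radius_ext w theta (sg_tau w))%E.
Proof.
have tau_r := tau_le_radius; have t_tau := tau_ge.
rewrite /radius_ext -/rho; case: ifPn => [|]; last first.
  rewrite negb_or -leNgt => /andP[tau_neq0 rho_le].
  have tauE : sg_tau w = rho by apply/eqP; rewrite eq_le tau_r.
  rewrite tauE in tau_neq0 *; apply: left_limit_theta_ge => //.
  exact: subcritical_le_radius.
case: (sg_tau w) tau_r t_tau => [u| |] //=; last first.
  by move=> _ _; rewrite ltNge leey.
move=> u_r; rewrite !lee_fin => tu cond.
apply: le_trans (pseries_le _ _ _ tu) _ => //.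
apply: theta_ge; first exact: le_trans tu.
(* If tau is 0, [radius_ext] takes the value at 0 even when the radius is 0; then [t <= tau] forces
   [t = 0]. *)
case/orP: cond => [/eqP[u0]|ur]; last first.
  by apply: is_cvg_theta => //; exact: le_trans tu.
rewrite u0 (_ : 0 = t); first exact: subcritical_cvg.
by apply/eqP; rewrite eq_le t_ge0 -u0.
Qed.

Lemma w0_over_theta_tau_subcritical n :
  0 <= w0_over_theta_tau w /\ w0_over_theta_tau w * pseries w t n <= w 0%N.
Proof.
have ge_n := subcritical_le_theta_tau; rewrite /w0_over_theta_tau.
(* The partial sum with one term is [w 0], which makes theta(tau) positive. *)
have := subcritical_le_theta_tau 1; rewrite {1}/pseries /series /= big_nat1 mulr1.
have := subcritical_le_theta_tau n; rewrite -/theta.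
case: (radius_ext _ _ _) => [x| |] //=; last first.
  by move=> _ _; rewrite mulr0 mul0r; split=> //; exact: ltW.
rewrite !lee_fin => le_n le_1; have x0 : 0 < x by apply: lt_le_trans le_1.
rewrite inver gt_eqF //= divr_ge0 ?(ltW x0) //; split=> //.
by rewrite mulrAC ler_pdivrMr // ler_wpM2l.
Qed.

End Subcritical.

End CriticalParameter.

(** * Limits of letter frequencies *)

Definition balanced (r : seq nat * seq nat) :=
  (size r.1 == size r.2) && (sumn r.1 == sumn r.2).

(** A finite exhaustion of the countably many balanced pairs, by their codes. *)
Definition relations (K : nat) : seq (seq nat * seq nat) :=
  [seq r <- pmap unpickle (iota 0 K) | balanced r].

Lemma mem_relations K r : balanced r -> (pickle r < K)%N -> r \in relations K.
Proof.
move=> br rK; rewrite mem_filter br mem_pmap; apply/mapP.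
by exists (pickle r); rewrite ?mem_iota ?pickleK.
Qed.

Lemma prod_nseq (R : pzSemiRingType) (f : nat -> R) n k : \prod_(d <- nseq n k) f d = f k ^+ n.
Proof. by rewrite big_nseq; elim: n => //= n ->; rewrite exprS. Qed.

Lemma exists_root (R : realType) (y : R) a : 0 <= y -> (0 < a)%N -> exists2 t, 0 <= t & t ^+ a = y.
Proof.
move=> y0 a0; exists (y `^ a%:R^-1); first exact: powR_ge0.
rewrite -powR_mulrn ?powR_ge0 // -powRrM mulVf ?powRr1 //.
by rewrite pnatr_eq0 -lt0n.
Qed.

Lemma le_of_mass (R : archiRealFieldType) (x y : R) : 0 <= x ->
  (forall n, (0 < n)%N -> x * (1 - n%:R^-1) <= y) -> x <= y.
Proof.
move=> x0 H; apply/ler_addgt0Pr => e e0.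
pose n := (Num.bound (x / e)).+1.
have n0 : 0 < n%:R :> R by rewrite ltr0n.
have := H n isT; rewrite mulrBr mulr1 => h.
suff : x / n%:R <= e by lra.
rewrite ler_pdivrMr // mulrC -ler_pdivrMr // ltW //.
have := archi_boundP (divr_ge0 x0 (ltW e0)) => /lt_le_trans; apply.
by rewrite ler_nat /n.
Qed.

(** A cluster point exists by compactness, and for an ultrafilter a cluster point is a limit. *)
Lemma ultra_cvg_bounded (R : realType) (T : Type) (G : set_system T) (f : T -> R) :
  UltraFilter G -> (forall k, 0 <= f k <= 1) -> exists l : R, f k @[k --> G] --> l.
Proof.
move=> UG f01; have PG : ProperFilter G by exact: ultra_proper.
have G01 : G (f @^-1` `[0, 1]).
  by apply: filterS filterT => k _; rewrite /= in_itv /=; exact: f01.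
have [l [_ cl]] := @segment_compact R 0 1 (f k @[k --> G]) _ G01.
exists l => B Bl; have [//|GB] := in_ultra_setVsetC (f @^-1` B) UG.
by have [x [/= fx]] := cl (~` B) B GB Bl.
Qed.

Section LetterFrequencies.
Variable R : realType.
Lemma sum_count_mem (f : nat -> R) n v :
  \sum_(0 <= k < n) f k * (count_mem k v)%:R = \sum_(d <- v | (d < n)%N) f d.
Proof.
elim: v => [|d v IH]; first by rewrite big_nil big1 // => k _; rewrite mulr0.
rewrite big_cons -IH; under eq_bigr do rewrite /= natrD mulrDr.
rewrite big_split /=; case: ltnP => dn; last first.
  rewrite big_nat_cond big1 ?add0r // => k /andP[/andP[_ kn] _].
  by rewrite (_ : (d == k) = false) ?mulr0 //; apply/eqP; lia.
rewrite (bigD1_seq d) /= ?mem_index_iota ?iota_uniq // eqxx mulr1 big1 ?addr0 //.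
by move=> k /negPf; rewrite eq_sym => ->; rewrite mulr0.
Qed.

Lemma sum_letter_freq (f : nat -> R) n v :
  \sum_(0 <= k < n) f k * letter_freq R v k =
  (\sum_(d <- v | (d < n)%N) f d) / (size v)%:R.
Proof.
rewrite -sum_count_mem mulr_suml.
by apply: eq_bigr => k _; rewrite mulrA.
Qed.

(** Markov's inequality: the mean letter is below 1, so a proportion of at most [1 / n] of the
    letters is [n] or more. This prevents mass from escaping in the limit. *)
Lemma letter_freq_mass n v : (sumn v < size v)%N -> (0 < n)%N ->
  1 - n%:R^-1 <= \sum_(0 <= k < n) letter_freq R v k.
Proof.
move=> ltv n0; have n0R : 0 < n%:R :> R by rewrite ltr0n.
have sv0 : 0 < (size v)%:R :> R by rewrite ltr0n; lia.
under eq_bigr do rewrite -[letter_freq _ _ _]mul1r.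
rewrite sum_letter_freq (_ : \sum_(_ <- _ | _) _ = (count (ltn^~ n) v)%:R); last first.
  by rewrite -sum1_count natr_sum.
rewrite ler_pdivlMr // mulrBl mul1r lerBlDl mulrC -lerBlDr.
rewrite ler_pdivlMr // -natrB ?count_size // -natrM ler_nat.
have -> : (size v - count (ltn^~ n) v = count (leq n) v)%N.
  rewrite -(count_predC (ltn^~ n)) addKn; apply: eq_count => k /=; lia.
apply: leq_trans (ltnW ltv); elim: v {ltv sv0} => //= d v.
by case: (leqP n d); lia.
Qed.

(** Over all letters, [d - 1] sums to [sumn v - size v < 0]; for nonempty ranges the letters left
    out contribute nonnegative terms. *)
Lemma letter_freq_drift n v : (sumn v < size v)%N ->
  \sum_(0 <= k < n) (k%:R - 1) * letter_freq R v k <= 0.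
Proof.
move=> ltv; case: n => [|n]; first by rewrite big_geq.
rewrite sum_letter_freq mulr_le0_ge0 // ?invr_ge0 //.
apply: (@le_trans _ _ (\sum_(d <- v) (d%:R - 1))).
  rewrite [leRHS](bigID (fun d => d < n.+1)%N) /= lerDl sumr_ge0 // => d.
  by rewrite -leqNgt subr_ge0 ler1n; lia.
rewrite sumrB -natr_sum -sumnE (_ : \sum_(_ <- _) 1 = (size v)%:R); last first.
  by rewrite -sum1_size natr_sum.
rewrite subr_le0 ler_nat.
exact: ltnW.
Qed.

End LetterFrequencies.

(** * Frequencies satisfying all exchange relations, and a compactness argument *)

Section Rigidity.
Variables (R : realType) (w : nat -> R).
Hypotheses (w0_gt0 : 0 < w 0%N) (w_ge0 : forall i, 0 <= w i).

Let c := w0_over_theta_tau w.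

Section LimitFrequencies.
Variable q : nat -> R.
Hypotheses (q_ge0 : forall k, 0 <= q k)
  (q_mass : forall n, (0 < n)%N -> 1 - n%:R^-1 <= \sum_(0 <= k < n) q k)
  (q_drift : forall n, \sum_(0 <= k < n) (k%:R - 1) * q k <= 0)
  (q_supp : forall k, w k = 0 -> q k = 0)
  (q_switch : forall r, balanced r ->
     word_weight w r.2 * \prod_(d <- r.1) q d = word_weight w r.1 * \prod_(d <- r.2) q d).

(** One positive letter [a] with [q a != 0] determines [t] through [t ^+ a], and the exchange
    relations propagate this to all letters; without such a letter [t = 0]. *)
Lemma limit_boltzmann : q 0%N != 0 ->
  exists2 t, 0 <= t & forall k, q k * w 0%N = q 0%N * w k * t ^+ k.
Proof.
move=> q0_neq0; have q0_gt0 : 0 < q 0%N by rewrite lt0r q0_neq0 q_ge0.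
have [[a [a_gt0 qa]]|none] := pselect (exists a, (0 < a)%N /\ q a != 0); last first.
  exists 0 => // -[|k]; first by rewrite expr0 mulr1.
  rewrite expr0n /= mulr0; have [->|qk] := eqVneq (q k.+1) 0; first by rewrite mul0r.
  by case: none; exists k.+1.
have wa : w a != 0 by apply: contra_neq qa; exact: q_supp.
have [||t t0 ta] := exists_root (y := q a * w 0%N / (q 0%N * w a)) (a := a) => //.
  by rewrite divr_ge0 ?mulr_ge0.
exists t => // k; apply/eqP.
rewrite -(@eqrXn2 _ a) ?mulr_ge0 ?exprn_ge0 //; apply/eqP.
(* Exchanging [a] letters [k] and [k] zeros for [k] letters [a] and [a] zeros yields the claim
   raised to the power [a]. *)
have := q_switch (r := (nseq a k ++ nseq k 0, nseq k a ++ nseq a 0)%N).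
rewrite /balanced /= !size_cat !size_nseq !sumn_cat !sumn_nseq addnC mulnC !mul0n !eqxx.
rewrite /word_weight !big_cat !prod_nseq => /(_ isT) /= H.
apply: (@mulfI _ (q 0%N ^+ k * w a ^+ k)); first by rewrite mulf_neq0 ?expf_neq0.
rewrite !exprMn exprAC ta.
transitivity (w a ^+ k * w 0%N ^+ a * (q k ^+ a * q 0%N ^+ k)); first by ring.
rewrite H expr_div_n !exprMn invfM.
by field; rewrite !expf_neq0.
Qed.

(** If [q 0 != 0], the drift condition on [q] makes the parameter [t] of [limit_boltzmann]
    subcritical, and total mass 1 turns the bound on [c * pseries w t n] into one on [c]. If
    [q 0 = 0], all mass sits at the letter 1, and [c] is shown not to be positive. *)
Lemma limit_freq0_ge : c <= q 0%N.
Proof.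
have [q0|q0] := eqVneq (q 0%N) 0; last first.
  have [t t0 qE] := limit_boltzmann q0.
  have q0_gt0 : 0 < q 0%N by rewrite lt0r q0 q_ge0.
  have drift_t n : drift w t n <= 0.
    rewrite -(pmulr_rle0 _ q0_gt0) /drift mulr_sumr.
    rewrite (_ : \sum_(_ <= _ < _) _ = w 0%N * \sum_(0 <= k < n) (k%:R - 1) * q k).
      by rewrite mulr_ge0_le0 // ltW.
    rewrite mulr_sumr; apply: eq_bigr => k _.
    transitivity ((k%:R - 1) * (q 0%N * w k * t ^+ k)); first by ring.
    by rewrite -qE; ring.
  have cP := w0_over_theta_tau_subcritical w0_gt0 w_ge0 t0 drift_t.
  have [c0 _] := cP 0%N.
  apply: le_of_mass => // n n0; have [_ cn] := cP n.
  apply: (@le_trans _ _ (c * \sum_(0 <= k < n) q k)); first by rewrite ler_wpM2l // q_mass.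
  rewrite -(ler_pM2r w0_gt0) -mulrA mulr_suml.
  under eq_bigr do rewrite qE -mulrA.
  by rewrite -mulr_sumr mulrCA ler_wpM2l.
(* With no zeros to compensate, a mean of at most 1 excludes letters above 1. *)
have q2 k : (1 < k)%N -> q k = 0.
  move=> k1; have := q_drift k.+1; rewrite big_nat_recr //=.
  have : 0 <= \sum_(0 <= i < k) (i%:R - 1) * q i.
    apply: sumr_ge0 => -[|i] _; first by rewrite q0 mulr0.
    by rewrite mulr_ge0 // subr_ge0 ler1n.
  move=> h1 h2; have : (k%:R - 1) * q k <= 0 by lra.
  rewrite pmulr_rle0 ?subr_gt0 ?ltr1n // => h3.
  by apply/eqP; rewrite eq_le h3 q_ge0.
have q1 : 0 < q 1%N.
  have := q_mass (n := 3) isT; rewrite !big_nat_recl // big_geq // q0 (q2 2%N) //.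
  by lra.
have w1 : 0 < w 1%N.
  by rewrite lt0r w_ge0 andbT; apply: contraTneq q1 => /q_supp ->; rewrite ltxx.
(* Exchange [k] ones for one letter [k] and [k - 1] zeros: the side containing [q k] vanishes, while
   [q 1] and [w 0] are positive. *)
have w2 k : (1 < k)%N -> w k = 0.
  move=> k1; have := q_switch (r := (nseq k 1, k :: nseq k.-1 0)%N).
  rewrite /balanced /= !size_nseq !sumn_nseq mul0n addn0 mul1n (ltn_predK k1) !eqxx.
  rewrite /word_weight !big_cons !prod_nseq (q2 k) // mul0r mulr0 => /(_ isT)/eqP.
  by rewrite !mulf_eq0 !expf_eq0 (gt_eqF q1) (gt_eqF w0_gt0) !andbF !orbF => /eqP.
have drift_t t n : 0 <= t -> drift w t n <= 0.
  move=> t0; apply: sumr_le0 => -[|[|k]] _; last by rewrite w2 // mulr0 mul0r.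
    by rewrite sub0r mulr1 mulN1r oppr_le0.
  by rewrite subrr !mul0r.
rewrite q0 leNgt; apply/negP => c_gt0.
(* Every [t] is now subcritical; this one has [c * w 1 * t = w 0], which leaves no room for
   [c * w 0 > 0]. *)
pose t := w 0%N / (c * w 1%N).
have t0 : 0 <= t by rewrite divr_ge0 // mulr_ge0 // ltW.
have [_] := w0_over_theta_tau_subcritical w0_gt0 w_ge0 t0 (fun n => drift_t t n t0) 2.
rewrite /pseries /series /= !big_nat_recl // big_geq // addr0 mulr1 expr1 -/c mulrDr.
rewrite (_ : c * (w 1%N * t) = w 0%N).
  by have := mulr_gt0 c_gt0 w0_gt0; lra.
by rewrite /t; field; rewrite !gt_eqF.
Qed.

End LimitFrequencies.

(** By contradiction and compactness: counterexamples [V K] for every [K] have limit frequencies [q]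
    that satisfy [limit_freq0_ge], although [q 0 <= c - e]. The resulting [K] is uniform in the
    length of [v]. *)
Lemma switching_rigidity e : 0 < e -> exists K, forall v, (sumn v < size v)%N ->
  {in v, forall d, 0 < w d} ->
  c - e - K%:R * \sum_(r <- relations K) switch_defect w v r ^+ 2 <= letter_freq R v 0.
Proof.
move=> e0; apply: contrapT => /forallNP noK.
have /choice[V VP] : forall K, exists v, [/\ (sumn v < size v)%N,
    {in v, forall d, 0 < w d} &
    letter_freq R v 0 < c - e - K%:R * \sum_(r <- relations K) switch_defect w v r ^+ 2].
  move=> K; have /existsNP[v /not_implyP[v1 /not_implyP[v2 /negP]]] := noK K.
  by rewrite -ltNge => v3; exists v.
(* An ultrafilter makes all letter frequencies converge at once. *)
have [G [UG subG]] := ultraFilterLemma (F := \oo) _.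
have PG : ProperFilter G by exact: ultra_proper.
have Gge n : G [set K | (n <= K)%N] by apply: subG; exact: nbhs_infty_ge.
have /choice[q qP] : forall i, exists l : R, letter_freq R (V K) i @[K --> G] --> l.
  by move=> i; apply: ultra_cvg_bounded => K; exact: letter_freq_bounds.
have sumP (f : nat -> R) n : \sum_(0 <= i < n) f i * letter_freq R (V K) i @[K --> G] -->
    \sum_(0 <= i < n) f i * q i.
  by apply: (@cvg_big _ _ _ _ _ (@add_continuous _)) => i _; exact: cvgZr.
(* As frequencies are nonnegative, the penalty with factor [K] stays below [c], so each fixed
   relation becomes exact in the limit. *)
have defect_le K r : balanced r -> (pickle r < K)%N ->
    switch_defect w (V K) r ^+ 2 <= c / K%:R.
  move=> br rK; have [_ _ VK] := VP K; have K0 : 0 < K%:R :> R by rewrite ltr0n; lia.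
  rewrite ler_pdivlMr // mulrC.
  have f0 : 0 <= letter_freq R (V K) 0 by have /andP[] := letter_freq_bounds R (V K) 0.
  apply: (@le_trans _ _ (K%:R * \sum_(r <- relations K) switch_defect w (V K) r ^+ 2)).
    rewrite ler_wpM2l // (big_rem r) ?mem_relations //= lerDl.
    by apply: sumr_ge0 => s _; exact: sqr_ge0.
  by lra.
have : c <= q 0%N.
  apply: limit_freq0_ge.
  - by move=> k; apply: cvgr_to_ge (qP k) _; near=> K; have /andP[] := letter_freq_bounds R (V K) k.
  - move=> n n0; under eq_bigr do rewrite -[q _]mul1r.
    apply: cvgr_to_ge (sumP _ _) _; near=> K; under eq_bigr do rewrite mul1r.
    by apply: letter_freq_mass => //; have [] := VP K.
  - move=> n; apply: cvgr_to_le (sumP _ _) _; near=> K.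
    by apply: letter_freq_drift; have [] := VP K.
  - move=> k wk; apply: cvg_unique (qP k) _ => //.
    rewrite (_ : (fun K => _) = cst 0); first exact: cvg_cst.
    apply/funext => K; have [_ VK _] := VP K.
    rewrite /letter_freq (_ : count_mem k (V K) = 0%N) ?mul0r //.
    by apply/count_memPn/negP => /VK; rewrite wk ltxx.
  - move=> r br; apply/eqP; rewrite -subr_eq0 -sqrf_eq0 eq_le sqr_ge0 andbT.
    have prodP al : freq_monomial R (V K) al @[K --> G] --> \prod_(d <- al) q d.
      by apply: (@cvg_big _ _ _ _ _ (@mul_continuous _)) => i _.
    have defP : switch_defect w (V K) r ^+ 2 @[K --> G] -->
      (word_weight w r.2 * \prod_(d <- r.1) q d - word_weight w r.1 * \prod_(d <- r.2) q d) ^+ 2.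
      apply: (@cvg_comp _ _ _ (fun K => switch_defect w (V K) r) (fun x => x ^+ 2)).
        by apply: cvgB; exact: cvgZr.
      exact: exprn_continuous.
    apply/ler_addgt0Pr => d d0; rewrite add0r.
    apply: cvgr_to_le defP _.
    pose n := maxn (pickle r).+1 (Num.bound (`|c| / d)).+1.
    apply: filterS (Gge n) => K /=; rewrite geq_max => /andP[rK nK].
    apply: le_trans (defect_le K r br rK) _.
    have K0 : 0 < K%:R :> R by rewrite ltr0n; lia.
    rewrite ler_pdivrMr // mulrC -ler_pdivrMr //.
    apply: le_trans (ler_norm _) _; rewrite normrM (ger0_norm (_ : 0 <= d^-1)) ?invr_ge0 ?ltW //.
    have := archi_boundP (divr_ge0 (normr_ge0 c) (ltW d0)) => /lt_le_trans; apply.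
    by rewrite ler_nat ltnW.
have : q 0%N <= c - e.
  apply: cvgr_to_le (qP 0%N) _; near=> K; have [_ _ VK] := VP K.
  apply: le_trans (ltW VK) _; rewrite gerBl mulr_ge0 //.
  by apply: sumr_ge0 => r _; exact: sqr_ge0.
by lra.
Unshelve. all: by end_near. Qed.

End Rigidity.

(** * Leaves and short cycles *)

Section Leaves.

(** In a contour, equal neighbours are an edge descended and climbed again at once, so its lower
    endpoint is a leaf. *)
Fixpoint repeats (T : eqType) (s : seq T) : nat :=
  if s is x :: s' then ((if s' is y :: _ then x == y else false) + repeats s')%N else 0.

Lemma repeats_cat (T : eqType) (s1 s2 : seq T) :
  (repeats s1 + repeats s2 <= repeats (s1 ++ s2))%N.
Proof.
elim: s1 => //= x s1 IH; rewrite -addnA leq_add //.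
by case: s1 {IH} => //=; case: s2.
Qed.

Lemma repeats_map (T T' : eqType) (f : T -> T') s : (repeats s <= repeats (map f s))%N.
Proof.
elim: s => //= x s IH; rewrite leq_add //; case: s {IH} => //= y s.
by case: eqP => // ->; rewrite eqxx.
Qed.

(** The last term is for the one-vertex tree, whose root is a leaf while its contour is empty. In
    larger trees each leaf hangs below an edge whose two steps are consecutive. *)
Lemma leaves_le_repeats t : (ndeg 0 t <= repeats (contour t) + (nvert t == 1))%N.
Proof.
elim: t => ts; rewrite [contour _]/= [ndeg _ _]/=.
have -> : nvert (Node ts) == 1%N = (size ts == 0%N).
  by case: ts => //= -[us] ts; rewrite addSn.
rewrite addnC => IH; rewrite leq_add2r.
have [i ->] : exists i, contour_from contour 0 ts = contour_from contour i ts.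
  by exists 0%N.
elim: ts i IH => // t ts IHts i [IHt IH].
rewrite [contour_from _ _ _]/= -cat_cons [sumn _]/=; apply: leq_trans (repeats_cat _ _); apply: leq_add; last first.
  by apply: IHts.
case: t IHt => -[|t us] IHt; first by rewrite /= eqxx.
apply: leq_trans IHt _; rewrite (_ : _ == 1%N = false) ?addn0; last first.
  by case: t {IH} => vs; apply/eqP => /=; lia.
set s := contour _; apply: leq_trans (repeats_map (cons i) s) _.
rewrite -cats1; move: (map _ s) => s'; apply: leq_trans (_ : repeats (s' ++ [:: [:: i]]) <= _)%N.
  by apply: leq_trans (repeats_cat _ _); rewrite leq_addr.
exact: leq_addl.
Qed.

Lemma repeatsE (T : eqType) (x0 : T) s :
  repeats s = (\sum_(a < size s) ((a.+1 < size s) && (nth x0 s a == nth x0 s a.+1)))%N.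
Proof.
elim: s => [|x s IH]; first by rewrite big_ord0.
rewrite big_ord_recl /= IH; congr (_ + _)%N; first by case: s {IH}.
Qed.

Variable n : nat.

Definition leaf_at (t : ptree n.+1) (a : 'I_(2 * n)) : bool :=
  (a.+1 < 2 * n)%N && (nth [::] (contour (val t)) a == nth [::] (contour (val t)) a.+1).

Lemma leaves_le_sum_leaf_at (t : ptree n.+1) : (0 < n)%N ->
  (ndeg 0 (val t) <= \sum_(a < 2 * n) leaf_at t a)%N.
Proof.
move=> n0; have := leaves_le_repeats (val t).
have size_t : size (contour (val t)) = (2 * n)%N by rewrite size_contour (eqP (valP t)).
rewrite (eqP (valP t)) (_ : n.+1 == 1%N = false); last by apply/eqP; lia.
by rewrite addn0 (repeatsE [::]) size_t.
Qed.

Lemma leaf_at_pair (t : ptree n.+1) (a b : 'I_(2 * n)) :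
  leaf_at t a -> b = a.+1 :> nat -> [set a; b]%SET \in val (contour_pairing t).
Proof.
move=> /andP[_ /eqP e] ba; rewrite inE; apply/existsP; exists a; apply/existsP; exists b.
by rewrite ba ltnSn eqxx e eqxx.
Qed.

Lemma ncpairing_block (P : ncpairing n) (A B : {set 'I_(2 * n)}) x :
  A \in val P -> B \in val P -> x \in A -> x \in B -> A = B.
Proof.
move=> AP BP xA xB; have /andP[/andP[/and3P[_ tI _] _] _] := valP P.
by rewrite -(def_pblock tI AP xA) (def_pblock tI BP xB).
Qed.

(** A common leaf at [a] makes [{a, a + 1}] a block of both pairings, hence a whole component, and
    different [a] give different components. *)
Lemma sum_leaf_at_le_ncycles (t t' : ptree n.+1) :
  (\sum_(a < 2 * n) leaf_at t a * leaf_at t' a <=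
   ncycles (contour_pairing t, contour_pairing t'))%N.
Proof.
set M := (_, _); pose e := meander_edge M.
have symE : connect_sym e by exact: meander_connect_sym.
pose A := [set a | leaf_at t a && leaf_at t' a]%SET.
have -> : (\sum_(a < 2 * n) leaf_at t a * leaf_at t' a = #|A|)%N.
  rewrite -sum1_card [RHS]big_mkcond /=; apply: eq_bigr => a _.
  by rewrite inE mulnb; case: (_ && _).
have injA : {in A &, injective (fingraph.root e)}.
  move=> a a'; rewrite !inE => /andP[la la'] /andP[ma ma'] /eqP.
  rewrite root_connect // => con.
  have [lt_a _] := andP la; pose b := Ordinal lt_a.
  have P1 := leaf_at_pair la (erefl : b = a.+1 :> nat).
  have P2 := leaf_at_pair la' (erefl : b = a.+1 :> nat).
  have cl : fingraph.closed e (mem [set a; b]%SET).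
    apply: (intro_closed symE) => x y /orP[] xy xab.
      by rewrite (ncpairing_block P1 xy xab) ?set21 // set22.
    by rewrite (ncpairing_block P2 xy xab) ?set21 // set22.
  (* So [a'] lies in [{a, a + 1}]. It cannot be [a + 1], since the blocks [{a, a + 1}] and
     [{a', a' + 1}] would then meet without being equal. *)
  have := closed_connect cl con; rewrite set21 => /esym; rewrite !inE.
  case/orP => /eqP // a'b; have [lt_a' _] := andP ma; pose b' := Ordinal lt_a'.
  have P3 := leaf_at_pair ma (erefl : b' = a'.+1 :> nat).
  have := ncpairing_block P1 P3 (x := b); rewrite set22 a'b set21 => /(_ isT isT)/setP/(_ a).
  by rewrite set21 !inE -!val_eqE /=; have /(congr1 val) /= := a'b; lia.
rewrite -(card_in_imset injA) /ncycles /n_comp_mem; apply: subset_leq_card.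
by apply/fintype.subsetP => _ /imsetP[a _ ->]; rewrite !inE /= andbT; exact: roots_root.
Qed.

End Leaves.

Lemma cauchy_schwarz_ord (R : realFieldType) N (p : 'I_N -> R) :
  (\sum_a p a) ^+ 2 <= N%:R * \sum_a p a ^+ 2.
Proof.
case: N p => [|N] p; first by rewrite !big_ord0 mulr0 expr0n.
set s := \sum_a p a; have N0 : 0 < N.+1%:R :> R by rewrite ltr0n.
have : 0 <= \sum_a (N.+1%:R * p a - s) ^+ 2 by apply: sumr_ge0 => a _; exact: sqr_ge0.
rewrite (eq_bigr (fun a => N.+1%:R ^+ 2 * p a ^+ 2 - 2 * N.+1%:R * s * p a + s ^+ 2)); last first.
  by move=> a _; ring.
rewrite big_split sumrB /= sumr_const card_ord -!mulr_sumr -/s -(mulr_natr (s ^+ 2)).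
rewrite (_ : _ + _ = N.+1%:R * (N.+1%:R * (\sum_a p a ^+ 2) - s ^+ 2)); last by ring.
by rewrite pmulr_rge0 // subr_ge0.
Qed.

(** * The expected number of leaves and the expected number of cycles *)

Section ExpectedLeaves.
Variables (R : realType) (w : nat -> R).

Lemma tree_weightE t : tree_weight w t = word_weight w (degrees t).
Proof.
have degrees_lt : {in degrees t, forall d, (d < nvert t)%N}.
  move=> d dt; rewrite -sumn_degrees ltnS; elim: (degrees t) dt => //= e v IH.
  by rewrite inE => /orP[/eqP ->|/IH]; lia.
rewrite /tree_weight; under eq_bigr do rewrite -count_degrees.
elim: (degrees t) degrees_lt => [|d v IH] ltN.
  by rewrite /word_weight big_nil big1.
rewrite /word_weight big_cons -/(word_weight w v) -IH => [|e ev]; last first.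
  by rewrite ltN // inE ev orbT.
under eq_bigr do rewrite /= exprD; rewrite big_split /=; congr (_ * _).
rewrite (bigD1_seq d) /= ?mem_index_iota ?iota_uniq ?ltN ?mem_head // eqxx expr1.
by rewrite big1 ?mulr1 // => e /negPf; rewrite eq_sym => ->.
Qed.

Hypothesis w_ge0 : forall i, 0 <= w i.

Lemma tree_weight_ge0 t : 0 <= tree_weight w t.
Proof. by rewrite tree_weightE; exact: word_weight_ge0. Qed.

Lemma tree_switching_variance r m : balanced r -> (size r.1 + size r.2 <= m.+1)%N ->
  \sum_(t : ptree m.+1) tree_weight w (val t) * switch_defect w (degrees (val t)) r ^+ 2 <=
  ((word_weight w r.1 + word_weight w r.2) ^+ 2 * ((size r.1 + size r.2) ^ 2)%:R / m.+1%:R)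
    * partition_function w m.+1.
Proof.
move=> /andP[/eqP sz /eqP sm] le_m.
(* Large enough for every out-degree and for every letter of [r]. *)
pose N := (m.+1 + sumn r.1 + sumn r.2).+1.
have leN : (m.+1 <= N)%N by rewrite /N; lia.
have ltN : {in r.1 ++ r.2, forall d, (d < N)%N}.
  move=> d dr; rewrite /N -addnA -sumn_cat; elim: (r.1 ++ r.2) dr => //= e v IH.
  by rewrite inE => /orP[/eqP ->|/IH]; lia.
have := switching_variance w_ge0 m sz sm ltN le_m.
set C := _ / _; pose G v := word_weight w v * switch_defect w v r ^+ 2.
have GP : perm_invariant G.
  move=> v v' vv'; rewrite /G /switch_defect (word_weight_perm w vv').
  by rewrite !(freq_monomial_perm _ _ vv').
have eG : \sum_(v <- words N m.+1) (sumn v == m)%:R * word_weight w v * switch_defect w v r ^+ 2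
    = m.+1%:R * \sum_(t : ptree m.+1) G (degrees (val t)).
  rewrite (sum_ptree GP leN); apply: eq_bigr => v _.
  by rewrite addn1 eqSS -mulrA.
have eW : \sum_(v <- words N m.+1) (sumn v == m)%:R * word_weight w v
    = m.+1%:R * \sum_(t : ptree m.+1) word_weight w (degrees (val t)).
  rewrite (sum_ptree (word_weight_perm w) leN); apply: eq_bigr => v _.
  by rewrite addn1 eqSS.
rewrite eG eW mulrCA ler_pM2l ?ltr0n // /partition_function.
under [in X in _ -> X]eq_bigr do rewrite tree_weightE.
by under [in X in _ -> _ <= X]eq_bigr do rewrite tree_weightE.
Qed.

Definition mean_leaves n : R :=
  \sum_(t : ptree n.+1) sg_prob w t * (ndeg 0 (val t))%:R.

Lemma sg_prob_ge0 n (t : ptree n.+1) : 0 < partition_function w n.+1 -> 0 <= sg_prob w t.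
Proof. by move=> Z0; rewrite divr_ge0 ?tree_weight_ge0 ?ltW. Qed.

Lemma expected_ncycles_ge0 n : 0 < partition_function w n.+1 -> 0 <= expected_ncycles w n.
Proof.
move=> Z0; apply: sumr_ge0 => t _; apply: sumr_ge0 => t' _.
by rewrite mulr_ge0 // mulr_ge0 // sg_prob_ge0.
Qed.

Lemma mean_leaves_ge0 n : 0 < partition_function w n.+1 -> 0 <= mean_leaves n.
Proof. by move=> Z0; apply: sumr_ge0 => t _; rewrite mulr_ge0 ?sg_prob_ge0. Qed.

Lemma expected_ncycles_ge n : (0 < n)%N -> 0 < partition_function w n.+1 ->
  mean_leaves n ^+ 2 / (2 * n)%:R <= expected_ncycles w n.
Proof.
move=> n0 Z0; rewrite ler_pdivrMr ?ltr0n ?muln_gt0 //.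
pose p (a : 'I_(2 * n)) := \sum_(t : ptree n.+1) sg_prob w t * (leaf_at t a)%:R.
have mean_le : mean_leaves n <= \sum_a p a.
  rewrite exchange_big /=; apply: ler_sum => t _; rewrite -mulr_sumr.
  by rewrite ler_wpM2l ?sg_prob_ge0 // -natr_sum ler_nat leaves_le_sum_leaf_at.
apply: (@le_trans _ _ ((\sum_a p a) ^+ 2)).
  have m0 := mean_leaves_ge0 Z0.
  by rewrite lerXn2r // nnegrE // (le_trans m0).
apply: le_trans (cauchy_schwarz_ord p) _; rewrite mulrC ler_wpM2r //.
have -> : \sum_a p a ^+ 2 = \sum_(t : ptree n.+1) \sum_(t' : ptree n.+1)
    sg_prob w t * sg_prob w t' * (\sum_(a < 2 * n) leaf_at t a * leaf_at t' a)%N%:R.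
  under [RHS]eq_bigr do under eq_bigr do rewrite natr_sum mulr_sumr.
  under [RHS]eq_bigr do rewrite exchange_big /=.
  rewrite [RHS]exchange_big /=; apply: eq_bigr => a _.
  rewrite expr2 mulr_suml; apply: eq_bigr => t _.
  rewrite mulr_sumr; apply: eq_bigr => t' _; rewrite natrM; ring.
apply: ler_sum => t _; apply: ler_sum => t' _.
apply: ler_wpM2l; first by rewrite mulr_ge0 // sg_prob_ge0.
by rewrite ler_nat; exact: sum_leaf_at_le_ncycles.
Qed.

Hypothesis w0_gt0 : 0 < w 0%N.

Let c := w0_over_theta_tau w.

(** The pointwise bound of [switching_rigidity] is averaged over the random tree. Its finitely many
    squared defects, weighted by [K], have total mean at most [D / n.+1], eventually below
    [e / 2]. *)
Lemma mean_leaves_ge e : 0 < e -> exists n0, forall n, (n0 <= n)%N ->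
  0 < partition_function w n.+1 -> n.+1%:R * (c - e) <= mean_leaves n.
Proof.
move=> e0; have e20 : 0 < e / 2 by rewrite divr_gt0.
have [K HK] := switching_rigidity w0_gt0 w_ge0 e20.
pose C r : R := (word_weight w r.1 + word_weight w r.2) ^+ 2 * ((size r.1 + size r.2) ^ 2)%:R.
pose D : R := K%:R * \sum_(r <- relations K) C r.
have C0 r : 0 <= C r by rewrite mulr_ge0 ?sqr_ge0.
have D0 : 0 <= D by rewrite mulr_ge0 // sumr_ge0.
(* From [n1] on, the trees have enough vertices for the variance bound of every relation used. *)
pose n1 := (\sum_(r <- relations K) (size r.1 + size r.2))%N.
exists (maxn n1 (Num.bound (D / (e / 2)))) => n; rewrite geq_max => /andP[n1n Dn] Z0.
have n0 : 0 < n.+1%:R :> R by rewrite ltr0n.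
have De : D / n.+1%:R <= e / 2.
  rewrite ler_pdivrMr // mulrC -ler_pdivrMr //.
  have := archi_boundP (divr_ge0 D0 (ltW e20)) => /ltW/le_trans; apply.
  by rewrite ler_nat leqW.
pose S v := K%:R * \sum_(r <- relations K) switch_defect w v r ^+ 2.
set Z := partition_function w n.+1 in Z0 *.
have Sbound : \sum_(t : ptree n.+1) tree_weight w (val t) * S (degrees (val t)) <= e / 2 * Z.
  apply: (@le_trans _ _ (D / n.+1%:R * Z)); last by rewrite ler_pM2r.
  under eq_bigr do rewrite /S mulrCA mulr_sumr.
  rewrite -mulr_sumr exchange_big /= /D -!mulrA ler_wpM2l // mulr_suml big_seq [leRHS]big_seq.
  apply: ler_sum => r rK; rewrite mulrA; apply: tree_switching_variance.
    by move: rK; rewrite mem_filter => /andP[].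
  apply: leq_trans (leqW n1n); rewrite /n1 (big_rem r) //=; exact: leq_addr.
suff lower : (c - e) * Z <=
    \sum_(t : ptree n.+1) tree_weight w (val t) * letter_freq R (degrees (val t)) 0.
  rewrite /mean_leaves mulrC -ler_pdivlMr // mulr_suml -(ler_pM2r Z0).
  apply: le_trans lower _; rewrite mulr_suml ler_sum // => t _.
  rewrite /sg_prob -/Z /letter_freq size_degrees (eqP (valP t)) count_degrees.
  rewrite [leRHS](_ : _ = tree_weight w (val t) * ((ndeg 0 (val t))%:R / n.+1%:R)) //.
  by field; rewrite !gt_eqF.
have : (c - e / 2) * Z <= \sum_(t : ptree n.+1) tree_weight w (val t) *
    (letter_freq R (degrees (val t)) 0 + S (degrees (val t))).
  rewrite /Z /partition_function mulr_sumr ler_sum // => t _; rewrite mulrC.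
  (* Rigidity concerns words with letters of positive weight; the other trees have weight 0. *)
  have [wt0|wt0] := eqVneq (tree_weight w (val t)) 0; first by rewrite wt0 !mul0r.
  rewrite ler_wpM2l ?tree_weight_ge0 // -lerBlDr; apply: HK.
    by rewrite size_degrees -sumn_degrees.
  move=> d dt; rewrite lt0r w_ge0 andbT; apply: contra_neq wt0 => wd.
  by rewrite tree_weightE /word_weight (big_rem d) //= wd mul0r.
under eq_bigr do rewrite mulrDr; rewrite big_split /=.
have -> : (c - e) * Z = (c - e / 2) * Z - e / 2 * Z by field.
by lra.
Qed.

End ExpectedLeaves.

(** * The asymptotic lower bound *)

Unset Implicit Arguments.

Theorem theorem2p9 (R : realType) (w : nat -> R)
    (w0_gt0 : 0 < w 0%N) (w_ge0 : forall i : nat, 0 <= w i) :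
  exists eps : nat -> R,
    (eps n @[n --> \oo] --> (0 : R)) /\
    forall n : nat, 0 < partition_function w n.+1 ->
      1 / 2 * w0_over_theta_tau w ^+ 2 * n%:R * (1 + eps n)
        <= expected_ncycles w n.
Proof.
set c := w0_over_theta_tau w.
(* The parameter [t = 0] is always subcritical. *)
have c0 : 0 <= c.
  have [n| ] := @w0_over_theta_tau_subcritical R w w0_gt0 w_ge0 0 (lexx _) _ 0; last by [].
  apply: sumr_le0 => -[|k] _; first by rewrite sub0r mulr1 mulN1r oppr_le0.
  by rewrite expr0n mulr0.
pose L n : R := 1 / 2 * c ^+ 2 * n%:R.
pose admissible n := (0 < L n) && (0 < partition_function w n.+1).
(* The negative part of the relative error, and 0 where the model is undefined or the bound [L n]
   vanishes. *)
pose eps n := if admissible n then Num.min 0 (expected_ncycles w n / L n - 1) else 0.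
exists eps; split; last first.
  move=> n Z0; rewrite -/(L n) /eps /admissible Z0 andbT.
  have L0 : 0 <= L n by rewrite !mulr_ge0 ?sqr_ge0.
  case: ifPn => [{}L0|]; last first.
    rewrite -leNgt => Ln; rewrite (_ : L n = 0) ?mul0r ?expected_ncycles_ge0 //.
    by apply/eqP; rewrite eq_le Ln.
  by rewrite mulrC -ler_pdivlMr // -lerBrDl ge_min lexx orbT.
apply/cvgrPdist_le => d d0.
have [c_eq0|c_neq0] := eqVneq c 0.
  near=> n; rewrite /eps /admissible /L c_eq0 expr0n mulr0 mul0r ltxx /=.
  by rewrite subrr normr0 ltW.
have c_gt0 : 0 < c by rewrite lt0r c_neq0.
(* The cap at 1 keeps [1 - d' / 2] nonnegative, so that the bound on the leaves can be squared. *)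
pose d' := Num.min d 1.
have d'0 : 0 < d' by rewrite lt_min d0 ltr01.
(* With this error the leaf bound is [n * c * (1 - d' / 2)], and [(1 - d' / 2) ^+ 2] is at least
   [1 - d]. *)
have e0 : 0 < c * d' / 2 by rewrite divr_gt0 ?mulr_gt0.
have [n0 Hn0] := mean_leaves_ge w_ge0 w0_gt0 e0.
near=> n.
have n0n : (n0 <= n)%N by near: n; exact: nbhs_infty_ge.
rewrite sub0r normrN /eps; case: ifPn => [/andP[L0 Z0]|_]; last by rewrite normr0 ltW.
have n_gt0 : (0 < n)%N by rewrite lt0n; apply: contraTneq L0 => ->; rewrite /L mulr0 ltxx.
have nR : 0 < n%:R :> R by rewrite ltr0n.
rewrite ler0_norm ?ge_min ?lexx // lerNl le_min oppr_le0 ltW //=.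
rewrite lerBrDr ler_pdivlMr //.
apply: le_trans (expected_ncycles_ge w_ge0 n_gt0 Z0).
have d1 : d' <= 1 by rewrite ge_min lexx orbT.
have dd : d' <= d by rewrite ge_min lexx.
have lower : n%:R * (c * (1 - d' / 2)) <= mean_leaves w n.
  apply: le_trans (Hn0 n n0n Z0); rewrite -/c (_ : c - _ = c * (1 - d' / 2)); last by field.
  by rewrite ler_wpM2r ?ler_nat // mulr_ge0 // subr_ge0; lra.
rewrite ler_pdivlMr ?ltr0n ?muln_gt0 // natrM.
apply: (@le_trans _ _ ((n%:R * (c * (1 - d' / 2))) ^+ 2)); last first.
  have h0 : 0 <= n%:R * (c * (1 - d' / 2)) by rewrite !mulr_ge0 // subr_ge0; lra.
  by rewrite lerXn2r // nnegrE // (le_trans h0).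
rewrite [leLHS](_ : _ = (n%:R * c) ^+ 2 * (1 - d)); last by rewrite /L; field.
rewrite [leRHS](_ : _ = (n%:R * c) ^+ 2 * (1 - d' / 2) ^+ 2); last by ring.
by rewrite ler_wpM2l ?sqr_ge0 //; have := sqr_ge0 (d' / 2); lra.
Unshelve. all: by end_near. Qed.
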